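(* Let $\Lambda_0\subset\mathbb{R}^d$ be an aperiodic and repetitive Delone set of finite local complexity with pattern space $\Omega$, and assume that the action of $\mathbb{R}^d$ on $\Omega$ by translations is uniquely ergodic with unique invariant probability measure $\mu$. Then $\mu$ is invariant for $(T_t)_{t>0}$, and for any $\Lambda\in\Omega$ we have $$\lim_{t\to\infty}T_t(\Lambda,\cdot)=\lim_{t\to\infty}T_t^*\delta_\Lambda=\mu$$ in the sense of weak convergence of measures.
   Context: Delone sets. $\Lambda\subset\mathbb{R}^d$ is a Delone set if it is uniformly discrete (there is $\varepsilon>0$ with $|\vec x-\vec y|>\varepsilon$ for all distinct $\vec x,\vec y\in\Lambda$) and relatively dense (there is $R>0$ with $\Lambda\cap B_R(\vec x)\ne\varnothing$ for all $\vec x\in\mathbb{R}^d$). A cluster is a finite subset of $\Lambda$. $\Lambda$ has finite local complexity if for every $R>0$ there are finitely many clusters $P_1,\dots,P_n$ such that for each $\vec x\in\mathbb{R}^d$ the set $B_R(\vec x)\cap\Lambda$ is a translate of some $P_i$. It is aperiodic if $\Lambda-\vec t=\Lambda$ implies $\vec t=\vec 0$. It is repetitive if for every cluster $P\subset\Lambda$ there is $R_P>0$ such that for every $\vec x\in\mathbb{R}^d$ the set $B_{R_P}(\vec x)\cap\Lambda$ contains a translate of $P$. Pattern space. Write $\varphi_{\vec t}(\Lambda)=\Lambda-\vec t$. Put $\varrho(\Lambda_1,\Lambda_2)=\min\{\bar\varrho(\Lambda_1,\Lambda_2),2^{-1/2}\}$, where $\bar\varrho(\Lambda_1,\Lambda_2)$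 is the infimum of all $\varepsilon>0$ such that there exist $\vec s,\vec t\in B_\varepsilon(\vec 0)$ with $B_{1/\varepsilon}(\vec 0)\cap\varphi_{\vec s}(\Lambda_1)=B_{1/\varepsilon}(\vec 0)\cap\varphi_{\vec t}(\Lambda_2)$. The pattern space $\Omega$ of $\Lambda_0$ is the closure of $\{\varphi_{\vec t}(\Lambda_0):\vec t\in\mathbb{R}^d\}$ with respect to the metric $\varrho$; it is a compact metric space of Delone sets on which $\mathbb{R}^d$ acts continuously by $\varphi$. Unique ergodicity means there is exactly one Borel probability measure $\mu$ on $\Omega$ invariant under all $\varphi_{\vec t}$. Semigroup. For $t>0$ and $f$ bounded Borel on $\Omega$, $T_tf(\Lambda)=\int_{\mathbb{R}^d}(2\pi t)^{-d/2}e^{-\|\vec s\|^2/(2t)}f(\varphi_{\vec s}(\Lambda))\,d\vec s$. For Borel $A\subset\Omega$, $T_t(\Lambda,A):=T_t\mathbf 1_A(\Lambda)=T_t^*\delta_\Lambda(A)$, where $T_t^*$ is the adjoint semigroup acting on finite measures and $\delta_\Lambda$ is the Dirac measure at $\Lambda$. $\mu$ is invariant for $(T_t)_{t>0}$ if $\int_\Omega T_tf\,d\mu=\int_\Omega f\,d\mu$ for all $f\in C(\Omega)$ and $t>0$. *)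

(* Defs.v *)
From HB Require Import structures.
From mathcomp Require Import all_boot all_order all_algebra.
From mathcomp Require Import all_classical all_reals all_analysis.
From mathcomp Require Import measurable_realfun.
From mathcomp Require Import ring lra.

Set Implicit Arguments.
Unset Strict Implicit.
Unset Printing Implicit Defensive.
Import Order.TTheory GRing.Theory Num.Theory.
Import numFieldNormedType.Exports.
Local Open Scope classical_set_scope.
Local Open Scope ring_scope.

Section Euclidean.
Context {R : realType} {d : nat}.
Implicit Types (x y t : 'rV[R]_d) (L P : set 'rV[R]_d).

(* The library norm on row vectors is the sup norm. *)
Definition enorm x : R := Num.sqrt (\sum_(i < d) x ord0 i ^+ 2).

(* Open balls; with closed balls [delone], [finite_local_complexity],
   [repetitive] and [rho] below are unchanged. *)
Definition eball x (r : R) : set 'rV[R]_d := [set y | enorm (y - x) < r].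

(* This is [L - t]. *)
Definition translate t L : set 'rV[R]_d := [set x - t | x in L].

Lemma enorm_ge0 x : 0 <= enorm x.
Proof. exact: sqrtr_ge0. Qed.

Lemma enorm_sum_ge0 x : 0 <= \sum_(i < d) x ord0 i ^+ 2.
Proof. by apply: sumr_ge0 => i _; exact: sqr_ge0. Qed.

Lemma enorm_sqr x : enorm x ^+ 2 = \sum_(i < d) x ord0 i ^+ 2.
Proof. exact/sqr_sqrtr/enorm_sum_ge0. Qed.

Lemma enorm0 : enorm 0 = 0.
Proof.
by rewrite /enorm big1 ?sqrtr0// => i _; rewrite mxE expr0n.
Qed.

Lemma enormN x : enorm (- x) = enorm x.
Proof.
by congr Num.sqrt; apply: eq_bigr => i _; rewrite mxE sqrrN.
Qed.

Lemma enormB x y : enorm (x - y) = enorm (y - x).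
Proof. by rewrite -enormN opprB. Qed.

Lemma enorm0_eq0 x : enorm x = 0 -> x = 0.
Proof.
move=> /eqP; rewrite sqrtr_eq0 => h; apply/rowP => i.
have /eqP : \sum_(i < d) x ord0 i ^+ 2 = 0.
  by apply/eqP; rewrite eq_le h enorm_sum_ge0.
rewrite psumr_eq0; last by move=> j _; exact: sqr_ge0.
by move=> /allP /(_ i (mem_index_enum _)); rewrite sqrf_eq0 mxE => /eqP.
Qed.

Lemma enormD x y : enorm (x + y) <= enorm x + enorm y.
Proof.
have [x0|x0] := eqVneq (enorm x) 0.
  by rewrite (enorm0_eq0 x0) enorm0 !add0r.
have [y0|y0] := eqVneq (enorm y) 0.
  by rewrite (enorm0_eq0 y0) enorm0 !addr0.
have xgt0 : 0 < enorm x by rewrite lt_neqAle eq_sym x0 enorm_ge0.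
have ygt0 : 0 < enorm y by rewrite lt_neqAle eq_sym y0 enorm_ge0.
have CS : \sum_(i < d) x ord0 i * y ord0 i <= enorm x * enorm y.
  pose t := enorm y / enorm x.
  have t0 : 0 < t by rewrite divr_gt0.
  have -> : enorm x * enorm y =
      \sum_(i < d) (t * x ord0 i ^+ 2 + t^-1 * y ord0 i ^+ 2) / 2.
    rewrite -mulr_suml big_split/= -!mulr_sumr -!enorm_sqr /t.
    by field; rewrite x0 y0.
  apply: ler_sum => i _; rewrite -subr_ge0.
  have -> : (t * x ord0 i ^+ 2 + t^-1 * y ord0 i ^+ 2) / 2 - x ord0 i * y ord0 i
      = t / 2 * (x ord0 i - t^-1 * y ord0 i) ^+ 2.
    by field; rewrite gt_eqF.
  by rewrite mulr_ge0 ?sqr_ge0// divr_ge0// ltW.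
rewrite -(@ler_pXn2r _ 2)// ?nnegrE ?addr_ge0 ?enorm_ge0//.
rewrite sqrrD !enorm_sqr.
have -> : \sum_(i < d) (x + y) ord0 i ^+ 2 = \sum_(i < d) x ord0 i ^+ 2 +
    (\sum_(i < d) x ord0 i * y ord0 i) *+ 2 + \sum_(i < d) y ord0 i ^+ 2.
  rewrite -sumrMnl -!big_split/=; apply: eq_bigr => i _.
  by rewrite mxE sqrrD.
by rewrite lerD2r lerD2l lerMn2r.
Qed.

Lemma enormBD x y : enorm (x - y) <= enorm x + enorm y.
Proof. by rewrite -(enormN y) enormD. Qed.

Lemma enorm_le_sum x : enorm x <= \sum_(i < d) `|x ord0 i|.
Proof.
rewrite -(@ler_pXn2r _ 2)// ?nnegrE ?enorm_ge0 ?sumr_ge0// enorm_sqr.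
elim: (index_enum _) => [|i s ih]; first by rewrite !big_nil expr0n.
rewrite !big_cons sqrrD real_normK ?num_real// -addrA lerD2l.
by rewrite (le_trans ih)// lerDr mulrn_wge0// mulr_ge0// sumr_ge0.
Qed.

Lemma translateP t L x : translate t L x <-> L (x + t).
Proof.
split=> [[y Ly <-]|Lx]; first by rewrite subrK.
by exists (x + t) => //; rewrite addrK.
Qed.

Lemma translate0 L : translate 0 L = L.
Proof. by apply/seteqP; split => x; rewrite translateP addr0. Qed.

Lemma translateD s t L : translate s (translate t L) = translate (t + s) L.
Proof.
by apply/seteqP; split => x; rewrite !translateP -addrA (addrC s).
Qed.

Definition uniformly_discrete L := exists2 e : R, 0 < e &
  forall x y, L x -> L y -> x <> y -> e < enorm (x - y).

Definition relatively_dense L := exists2 r : R, 0 < r &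
  forall x, L `&` eball x r !=set0.

Definition delone L := uniformly_discrete L /\ relatively_dense L.

(* [cluster] is taken: MathComp-Analysis uses it for cluster points. *)
Definition is_cluster L P := finite_set P /\ P `<=` L.

Definition finite_local_complexity L := forall r : R, 0 < r ->
  exists (n : nat) (P : 'I_n -> set 'rV[R]_d),
    (forall i, is_cluster L (P i)) /\
    forall x, exists i t, eball x r `&` L = translate t (P i).

Definition aperiodic L := forall t, translate t L = L -> t = 0.

Definition repetitive L := forall P, is_cluster L P ->
  exists2 r : R, 0 < r & forall x, exists t, translate t P `<=` eball x r `&` L.

End Euclidean.

Section Metric.
Context {R : realType} {d : nat}.
Implicit Types (x y t : 'rV[R]_d) (L : set 'rV[R]_d) (e : R).

Definition agree e L1 L2 := exists s t,
  [/\ eball 0 e s, eball 0 e t &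
      eball 0 e^-1 `&` translate s L1 = eball 0 e^-1 `&` translate t L2].

(* [ereal_inf] is [+oo] on the empty set, so the truncation at [2^(-1/2)]
   also covers pairs that are [agree] for no [e]. *)
Definition rho_bar L1 L2 : \bar R :=
  ereal_inf [set e%:E | e in [set e | 0 < e /\ agree e L1 L2]].

Definition rho L1 L2 : R := fine (mine (rho_bar L1 L2) (Num.sqrt 2)^-1%:E).

Let c : R := (Num.sqrt 2)^-1.

Let c_gt0 : 0 < c.
Proof. by rewrite invr_gt0 sqrtr_gt0. Qed.

Let c_sqr : c ^+ 2 = 2^-1.
Proof. by rewrite exprVn sqr_sqrtr. Qed.

Lemma rho_bar_ge0 L1 L2 : (0 <= rho_bar L1 L2)%E.
Proof.
by apply: le_ereal_inf_tmp => _ [e [e0 _] <-]; rewrite lee_fin ltW.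
Qed.

Lemma rhoE L1 L2 : (rho L1 L2)%:E = mine (rho_bar L1 L2) c%:E.
Proof.
rewrite /rho fineK// fin_real//; apply/andP; split.
  by rewrite lt_min ltNyr andbT (lt_le_trans _ (rho_bar_ge0 _ _)).
by rewrite gt_min ltry orbT.
Qed.

Lemma rho_ge0 L1 L2 : 0 <= rho L1 L2.
Proof. by rewrite -lee_fin rhoE le_min rho_bar_ge0/= lee_fin ltW. Qed.

Lemma rho_le_c L1 L2 : rho L1 L2 <= c.
Proof. by rewrite -lee_fin rhoE ge_min lexx orbT. Qed.

Lemma agree_rho e L1 L2 : 0 < e -> agree e L1 L2 -> rho L1 L2 <= e.
Proof.
move=> e0 h; rewrite -lee_fin rhoE ge_min; apply/orP; left.
by apply: ge_ereal_inf; exists e%:E => //; exists e.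
Qed.

Lemma rho_agree e L1 L2 : rho L1 L2 < e -> e <= c ->
  exists e', [/\ 0 < e', e' < e & agree e' L1 L2].
Proof.
rewrite -lte_fin rhoE gt_min => /orP[|]; last first.
  by rewrite lte_fin => h1 h2; have := lt_le_trans h1 h2; rewrite ltxx.
move=> /ereal_inf_lt[_ [e' [e'0 h] <-]]; rewrite lte_fin => e'e _.
by exists e'.
Qed.

Lemma eball0 x e : eball 0 e x = (enorm x < e) :> Prop.
Proof. by rewrite /eball/= subr0. Qed.

Lemma agree_translate e e' t L1 L2 : 0 < e -> e <= e' ->
  e'^-1 + enorm t <= e^-1 -> agree e L1 L2 ->
  agree e' (translate t L1) (translate t L2).
Proof.
move=> e0 ee' h [u [v []]]; rewrite !eball0 => ue ve E.
exists u, v; split; rewrite ?eball0 ?(lt_le_trans _ ee')//.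
have key x : enorm x < e'^-1 -> eball 0 e^-1 (x + t).
  move=> xe; rewrite eball0 (le_lt_trans (enormD _ _))// (lt_le_trans _ h)//.
  by rewrite ltrD2r.
apply/seteqP; split => x [xe]; rewrite !translateP => Lx; split => //;
  rewrite !translateP addrAC; apply/translateP.
- have : (eball 0 e^-1 `&` translate u L1) (x + t).
    by split; [by apply: key; rewrite -eball0|rewrite translateP addrAC].
  by rewrite E => -[].
- have : (eball 0 e^-1 `&` translate v L2) (x + t).
    by split; [by apply: key; rewrite -eball0|rewrite translateP addrAC].
  by rewrite -E => -[].
Qed.

Lemma agree_le e e' L1 L2 : 0 < e -> e <= e' -> agree e L1 L2 -> agree e' L1 L2.
Proof.
move=> e0 ee' h; rewrite -(translate0 L1) -(translate0 L2).
apply: agree_translate h => //.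
by rewrite enorm0 addr0 lef_pV2// posrE// (lt_le_trans e0).
Qed.

Lemma agree_refl e L t : 0 < e -> enorm t < e -> agree e L (translate t L).
Proof.
move=> e0 te; exists t, 0; rewrite !eball0 enorm0; split => //.
by rewrite translate0.
Qed.

Lemma agree_sym e L1 L2 : agree e L1 L2 -> agree e L2 L1.
Proof. by move=> [s [t [? ? ?]]]; exists t, s; split. Qed.

Lemma agree_trans e1 e2 L1 L2 L3 : 0 < e1 -> 0 < e2 -> e1 <= c -> e2 <= c ->
  agree e1 L1 L2 -> agree e2 L2 L3 -> agree (e1 + e2) L1 L3.
Proof.
move=> e10 e20 e1c e2c [s1 [t1 []]] + + E1 [s2 [t2 []]].
rewrite !eball0 => s1e t1e s2e t2e E2.
exists (s1 + s2), (t2 + t1); rewrite !eball0; split.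
- by rewrite (le_lt_trans (enormD _ _))// ltrD.
- by rewrite (le_lt_trans (enormD _ _))// addrC ltrD.
have e12 : 0 < e1 + e2 by exact: addr_gt0.
have key a b : 0 < a -> 0 < b -> a <= c -> b <= c -> (a + b)^-1 + b <= a^-1.
  move=> a0 b0 ac bc; rewrite -subr_ge0.
  have -> : a^-1 - ((a + b)^-1 + b) = b * (1 - a * (a + b)) / (a * (a + b)).
    by field; rewrite !gt_eqF// addr_gt0.
  have h : a * (a + b) <= 1.
    rewrite mulrDr; apply: (@le_trans _ _ (c ^+ 2 + c ^+ 2)); last first.
      by rewrite c_sqr; lra.
    by rewrite lerD// expr2 ler_pM// ltW.
  by rewrite divr_ge0// mulr_ge0// ?subr_ge0// ltW// addr_gt0.
have k1 := key _ _ e10 e20 e1c e2c.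
have k2 := key _ _ e20 e10 e2c e1c.
rewrite (addrC e2) in k2.
apply/seteqP; split => x [+]; rewrite !eball0 !translateP => xe Lx; split => //;
  rewrite ?eball0// translateP.
- have : (eball 0 e1^-1 `&` translate s1 L1) (x + s2).
    split; last by rewrite translateP -addrA (addrC s2).
    rewrite eball0 (le_lt_trans (enormD _ _))// (lt_le_trans _ k1)//.
    by rewrite ltrD.
  rewrite E1 => -[_]; rewrite translateP => L2x.
  have : (eball 0 e2^-1 `&` translate s2 L2) (x + t1).
    split; last by rewrite translateP addrAC.
    rewrite eball0 (le_lt_trans (enormD _ _))// (lt_le_trans _ k2)//.
    by rewrite ltrD.
  by rewrite E2 => -[_]; rewrite translateP -addrA (addrC t1).
- have : (eball 0 e2^-1 `&` translate t2 L3) (x + t1).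
    split; last by rewrite translateP -addrA (addrC t1).
    rewrite eball0 (le_lt_trans (enormD _ _))// (lt_le_trans _ k2)//.
    by rewrite ltrD.
  rewrite -E2 => -[_]; rewrite translateP => L2x.
  have : (eball 0 e1^-1 `&` translate t1 L2) (x + s2).
    split; last by rewrite translateP addrAC.
    rewrite eball0 (le_lt_trans (enormD _ _))// (lt_le_trans _ k1)//.
    by rewrite ltrD.
  by rewrite -E1 => -[_]; rewrite translateP -addrA (addrC s2).
Qed.

Lemma rhoxx L : rho L L = 0.
Proof.
apply/eqP; rewrite eq_le rho_ge0 andbT; apply/ler_addgt0Pl => e e0.
rewrite addr0; apply: agree_rho => //; rewrite -{2}(translate0 L).
by apply: agree_refl; rewrite ?enorm0.
Qed.

Lemma rho_sym L1 L2 : rho L1 L2 = rho L2 L1.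
Proof.
rewrite /rho; congr (fine (mine (ereal_inf _) _)).
by apply/seteqP; split => _ [e [e0 h] <-]; exists e => //;
  split => //; exact: agree_sym.
Qed.

Lemma rho_triangle L2 L1 L3 : rho L1 L3 <= rho L1 L2 + rho L2 L3.
Proof.
apply/ler_addgt0Pl => e e0; rewrite leNgt; apply/negP => h.
have r12 : rho L1 L2 + e / 2 <= c.
  rewrite leNgt; apply/negP => h'; have := rho_le_c L1 L3.
  by have := rho_ge0 L2 L3; move: h h'; lra.
have r23 : rho L2 L3 + e / 2 <= c.
  rewrite leNgt; apply/negP => h'; have := rho_le_c L1 L3.
  by have := rho_ge0 L1 L2; move: h h'; lra.
have [|a [a0 a1 ca]] := @rho_agree _ L1 L2 _ r12; first by lra.
have [|b [b0 b1 cb]] := @rho_agree _ L2 L3 _ r23; first by lra.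
have ab : 0 < a + b by rewrite addr_gt0.
have := agree_rho ab (agree_trans a0 b0 (ltW (lt_le_trans a1 r12))
  (ltW (lt_le_trans b1 r23)) ca cb).
lra.
Qed.

Lemma rho_eq0_sub L1 L2 : uniformly_discrete L2 -> rho L1 L2 = 0 -> L1 `<=` L2.
Proof.
move=> [r r0 L2r] r12 x Lx.
have x1 : 0 < enorm x + 1 by rewrite ltr_wpDl// enorm_ge0.
have U e : 0 < e -> exists2 u, enorm u < e & L2 (x + u).
  move=> e0.
  pose a := Num.min (Num.min c (e / 2)) (Num.min (enorm x + 1)^-1 2^-1).
  have [a0 ac ae ax a2] : [/\ 0 < a, a <= c, a <= e / 2,
      a <= (enorm x + 1)^-1 & a <= 2^-1].
    by rewrite /a; split;
      rewrite ?lt_min ?c_gt0 ?divr_gt0 ?invr_gt0 ?x1//= ?ge_min ?lexx ?orbT.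
  have [|b [b0 ba [s [t []]]]] := @rho_agree a L1 L2 _ ac; first by rewrite r12.
  rewrite !eball0 => sb tb E.
  have : (eball 0 b^-1 `&` translate s L1) (x - s).
    split; last by rewrite translateP subrK.
    rewrite eball0 (le_lt_trans (enormBD _ _))//.
    have : enorm x + 1 <= b^-1.
      by rewrite -[leLHS]invrK lef_pV2 ?posrE ?invr_gt0// (le_trans _ ax)// ltW.
    by move: sb ba a2; lra.
  rewrite E => -[_]; rewrite translateP -addrA => Lx2.
  exists (- s + t) => //; rewrite (le_lt_trans (enormD _ _))// enormN.
  by move: sb tb ba ae; lra.
have [|u ur Lu] := U (r / 2); first by rewrite divr_gt0.
suff u0 : enorm u = 0 by rewrite -[x]addr0 -(enorm0_eq0 u0).
apply/eqP; rewrite eq_le enorm_ge0 andbT; apply/ler_addgt0Pl => e e0.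
rewrite addr0.
have [|v ve Lv] := U (Num.min e (r / 2)); first by rewrite lt_min e0 divr_gt0.
move: ve; rewrite lt_min => /andP[ve vr].
have [/addrI <-|vu] := pselect (x + v = x + u); first exact: ltW.
have := L2r _ _ Lv Lu vu.
rewrite opprD addrACA subrr add0r => h.
by have := enormBD v u; move: h vr ur; lra.
Qed.

Lemma rho_eq0 L1 L2 : uniformly_discrete L1 -> uniformly_discrete L2 ->
  rho L1 L2 = 0 -> L1 = L2.
Proof.
move=> d1 d2 r12; apply/seteqP; split; apply: rho_eq0_sub => //.
by rewrite rho_sym.
Qed.

End Metric.

Record delone_set (R : realType) (d : nat) := DeloneSet {
  delone_val :> set 'rV[R]_d ;
  deloneP : delone delone_val }.

HB.instance Definition _ (R : realType) (d : nat) :=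
  gen_eqMixin (delone_set R d).
HB.instance Definition _ (R : realType) (d : nat) :=
  gen_choiceMixin (delone_set R d).

Section DeloneMetric.
Context {R : realType} {d : nat}.
Implicit Types (L : delone_set R d) (t : 'rV[R]_d).

Lemma delone_val_inj : injective (@delone_val R d).
Proof.
move=> [L1 D1] [L2 D2]/= E; subst L2; congr DeloneSet; exact: Prop_irrelevance.
Qed.

Lemma delone_rho_eq0 L1 L2 : rho L1 L2 = 0 -> L1 = L2.
Proof.
by move=> h; apply: delone_val_inj; apply: rho_eq0 h;
  [have [] := deloneP L1|have [] := deloneP L2].
Qed.

HB.instance Definition _ := @isMetric.Build R (delone_set R d)
  (fun L1 L2 => rho L1 L2) (fun L => rhoxx L) delone_rho_eq0
  (fun L1 L2 => rho_sym L1 L2) (fun L1 L2 L3 => rho_triangle L1 L2 L3).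

Lemma delone_translate t L : delone (translate t L).
Proof.
have [[e e0 Le] [r r0 Lr]] := deloneP L; split.
  exists e => // x y; rewrite !translateP => Lx Ly xy.
  have := Le _ _ Lx Ly; rewrite opprD addrACA subrr addr0; apply.
  by move=> /addIr.
exists r => // x; have [y [Ly xy]] := Lr (x + t).
exists (y - t); rewrite /= translateP subrK; split => //.
by move: xy; rewrite /eball/= opprD addrA addrAC.
Qed.

Definition dshift t L : delone_set R d := DeloneSet (delone_translate t L).

Lemma shiftD s t L : dshift s (dshift t L) = dshift (t + s) L.
Proof. by apply: delone_val_inj; rewrite /= translateD. Qed.

Lemma shift0 L : dshift 0 L = L.
Proof. by apply: delone_val_inj; rewrite /= translate0. Qed.

Lemma ball_deloneE L e L' : ball L e L' = (rho L L' < e) :> Prop.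
Proof. by rewrite ballEmdist. Qed.

Lemma rho_shift t L : rho L (dshift t L) <= enorm t.
Proof.
apply/ler_addgt0Pl => e e0; apply: agree_rho.
  by rewrite ltr_wpDr// enorm_ge0.
by apply: agree_refl; rewrite ?ltrDr// ltr_wpDr// enorm_ge0.
Qed.

Lemma rho_shift_lt t e : 0 < e -> exists2 a : R, 0 < a &
  forall L L', rho L L' < a -> rho (dshift t L) (dshift t L') < e.
Proof.
move=> e0; have e20 : 0 < e / 2 by rewrite divr_gt0.
have h0 : 0 < (e / 2)^-1 + enorm t by rewrite ltr_wpDr ?invr_gt0// enorm_ge0.
pose a := Num.min ((e / 2)^-1 + enorm t)^-1 (Num.sqrt 2)^-1.
have [ah ac] : a <= ((e / 2)^-1 + enorm t)^-1 /\ a <= (Num.sqrt 2)^-1.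
  by rewrite /a; split; rewrite ge_min lexx ?orbT.
exists a => [|L L' LL'].
  by rewrite lt_min !invr_gt0 h0 sqrtr_gt0/= ltr0n.
have [b [b0 ba cb]] := rho_agree LL' ac.
have hb : (e / 2)^-1 + enorm t <= b^-1.
  by rewrite -[leLHS]invrK lef_pV2 ?posrE ?invr_gt0// (le_trans (ltW ba)).
have be : b <= e / 2.
  rewrite -[leRHS]invrK -[leLHS]invrK lef_pV2 ?posrE ?invr_gt0//.
  by rewrite (le_trans _ hb)// lerDl enorm_ge0.
apply: (@le_lt_trans _ _ (e / 2)); last by lra.
exact/agree_rho/(agree_translate b0 be hb cb).
Qed.

Lemma shift_continuous t : continuous (dshift t).
Proof.
move=> L U /nbhs_ballP[e /= e0 eU].
have [a a0 h] := rho_shift_lt t e0.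
apply/nbhs_ballP; exists a => //= L'; rewrite ball_deloneE => /h LL'.
by apply: eU; rewrite ball_deloneE.
Qed.

Lemma shift_near t L (U : set (delone_set R d)) : nbhs (dshift t L) U ->
  exists2 a : R, 0 < a & forall s L', enorm (s - t) < a -> ball L a L' ->
    U (dshift s L').
Proof.
move=> /nbhs_ballP[e /= e0 eU].
have [|a a0 h] := @rho_shift_lt t (e / 2); first by rewrite divr_gt0.
exists (Num.min a (e / 2)); first by rewrite lt_min a0 divr_gt0.
move=> s L'; rewrite ball_deloneE !lt_min => /andP[_ st] /andP[LL' _].
apply: eU; rewrite ball_deloneE.
apply: (le_lt_trans (rho_triangle (dshift t L') _ _)).
have -> : dshift s L' = dshift (s - t) (dshift t L').
  by rewrite shiftD addrC subrK.
rewrite [ltRHS]splitr ltrD//; first exact: h.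
exact: le_lt_trans (rho_shift _ _) st.
Qed.

End DeloneMetric.

Section PatternSpace.
Context {R : realType} {d : nat} (L0 : delone_set R d).

(* The closure is taken in the metric space [delone_set R d]. *)
Definition pattern_set : set (delone_set R d) :=
  closure [set dshift t L0 | t in [set: 'rV[R]_d]].

Definition Omega : Type := set_type pattern_set.

HB.instance Definition _ := PseudoMetric.copy Omega (set_type pattern_set).

Lemma pattern_set_self : L0 \in pattern_set.
Proof.
by rewrite inE; apply: subset_closure; exists 0; rewrite ?shift0.
Qed.

HB.instance Definition _ :=
  isPointed.Build Omega (exist _ L0 pattern_set_self).

Lemma pattern_set_shift t (L : delone_set R d) :
  L \in pattern_set -> dshift t L \in pattern_set.
Proof.
rewrite !inE => LO U /(shift_continuous (x := L)) /LO[_ [[s _ <-] Us]].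
exists (dshift t (dshift s L0)); split => //.
by exists (s + t); rewrite ?shiftD.
Qed.

Definition phi t (L : Omega) : Omega :=
  exist _ (dshift t (val L)) (pattern_set_shift t (valP L)).

(* The type [Omega] again, carrying the Borel sigma-algebra. *)
Definition Borel := g_sigma_algebraType (@open Omega).

End PatternSpace.

Section Lebesgue.
Context {R : realType}.
Local Notation mR := (measurableTypeR R).

Definition tcons n (p : mR * n.-tuple mR) : n.+1.-tuple mR :=
  [the n.+1.-tuple mR of p.1 :: p.2].

Lemma measurable_tcons n : measurable_fun [set: mR * n.-tuple mR] (@tcons n).
Proof. exact: measurable_cons. Qed.

HB.instance Definition _ n :=
  isMeasurableFun.Build _ _ _ _ (@tcons n) (@measurable_tcons n).

Section step.
Variables (n : nat) (m : {sigma_finite_measure set (n.-tuple mR) -> \bar R}).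

Definition lebesgue_step : set (n.+1.-tuple mR) -> \bar R :=
  pushforward ((@lebesgue_measure R) \x m)%E (@tcons n).

Let step0 : lebesgue_step set0 = 0%E.
Proof. exact: measure0. Qed.

Let step_ge0 A : (0 <= lebesgue_step A)%E.
Proof. exact: measure_ge0. Qed.

Let step_sigma_additive : semi_sigma_additive lebesgue_step.
Proof. exact: measure_semi_sigma_additive. Qed.

HB.instance Definition _ := isMeasure.Build _ _ _ lebesgue_step
  step0 step_ge0 step_sigma_additive.

Let step_sigma_finite : sigma_finite setT lebesgue_step.
Proof.
have /sigma_finiteP[F [FT Fnd Foo]] := sigma_finiteT (@lebesgue_measure R).
have /sigma_finiteP[G [GT Gnd Goo]] := sigma_finiteT m.
pose g (s : n.+1.-tuple mR) := (thead s, [tuple of behead s]).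
have mg : measurable_fun setT g.
  apply/measurable_fun_pairP; split; first exact: measurable_tnth.
  exact: measurable_behead.
have gK : cancel (@tcons n) g.
  by move=> [x s]; congr pair; apply/val_inj.
exists (fun k => g @^-1` (F k `*` G k)).
  apply/seteqP; split => // s _.
  have [i _ Fi] : (\bigcup_i F i) (g s).1 by rewrite -FT.
  have [j _ Gj] : (\bigcup_j G j) (g s).2 by rewrite -GT.
  exists (maxn i j) => //; split.
    by move: Fi; apply/subsetPset/Fnd; exact: leq_maxl.
  by move: Gj; apply/subsetPset/Gnd; exact: leq_maxr.
move=> k; have [mF Fk] := Foo k; have [mG Gk] := Goo k; split.
  by rewrite -[X in measurable X]setTI; apply: mg => //; exact: measurableX.
rewrite /lebesgue_step /pushforward -comp_preimage (_ : g \o _ = id).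
  by rewrite preimage_id product_measure1E// lte_mul_pinfty// ge0_fin_numE.
by apply/funext => p /=; rewrite gK.
Qed.

HB.instance Definition _ := Measure_isSigmaFinite.Build _ _ _ lebesgue_step
  step_sigma_finite.

End step.

(* Lebesgue measure on [R^d], as an iterated product.  MathComp-Analysis puts
   the product sigma-algebra on tuples, so [d]-tuples are used as integration
   variables and [vec] below turns them into row vectors. *)
Fixpoint lebesgue (d : nat) :
    {sigma_finite_measure set (d.-tuple mR) -> \bar R} :=
  match d with
  | 0 => \d_([tuple] : 0.-tuple mR)
  | n.+1 => lebesgue_step (lebesgue n)
  end.

End Lebesgue.

Definition vec {R : realType} {d : nat} (s : d.-tuple (measurableTypeR R)) :
    'rV[R]_d :=
  \row_i tnth s i.

Section Heat.
Context {R : realType} {d : nat} (L0 : delone_set R d).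

Definition gauss (t : R) (s : 'rV[R]_d) : R :=
  (2 * pi * t) `^ (- (d%:R / 2)) * expR (- (enorm s ^+ 2 / (2 * t))).

(* Meant for [0 < t] and [f] bounded and Borel. *)
Definition heat_semigroup (t : R) (f : Omega L0 -> R) (L : Omega L0) : \bar R :=
  \int[lebesgue d]_s (gauss t (vec s) * f (phi (vec s) L))%:E.

Lemma gauss_ge0 t s : 0 <= gauss t s.
Proof. by rewrite mulr_ge0 ?powR_ge0 ?expR_ge0. Qed.

Lemma measurable_gauss t :
  measurable_fun [set: d.-tuple (measurableTypeR R)] (gauss t \o vec).
Proof.
apply: measurable_funM => //=; apply: measurableT_comp => //.
apply: measurableT_comp => //; apply: measurable_funM => //.
under eq_fun do rewrite enorm_sqr.
apply: measurable_sum => i; apply: measurable_funX.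
under eq_fun do rewrite mxE.
exact: measurable_tnth.
Qed.

Definition box (q : d.-tuple (rat * rat)) :
    set (d.-tuple (measurableTypeR R)) :=
  [set s | forall i, tnth s i \in `](ratr (tnth q i).1), (ratr (tnth q i).2)[].

Lemma measurable_box q : measurable (box q).
Proof.
have -> : box q = \big[setI/setT]_(i < d)
    ((@tnth d R)^~ i @^-1`
      [set` `](ratr (tnth q i).1 : R), (ratr (tnth q i).2)[]).
  apply/seteqP; split => s.
    by move=> h; rewrite -bigcap_seq => i _; exact: h.
  by rewrite -bigcap_seq => h i; apply: (h i); rewrite /= mem_index_enum.
apply: bigsetI_measurable => i _; rewrite -[X in measurable X]setTI.
exact: measurable_tnth.
Qed.

Lemma box_nbhs (s : d.-tuple (measurableTypeR R)) (a : R) : 0 < a ->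
  exists2 q, box q s & forall s', box q s' -> enorm (vec s' - vec s) < a.
Proof.
move=> a0; pose b := a / (d%:R + 1).
have d0 : 0 < d%:R + 1 :> R by rewrite ltr_wpDl.
have b0 : 0 < b by rewrite divr_gt0.
pose P (i : 'I_d) (p : rat * rat) :=
  [/\ tnth s i - b / 2 < ratr p.1, ratr p.1 < tnth s i,
      tnth s i < ratr p.2 & ratr p.2 < tnth s i + b / 2].
have /choice[p Pp] : forall i, exists p, P i p.
  move=> i.
  have [|x] := @rat_in_itvoo R (tnth s i - b / 2) (tnth s i); first by lra.
  rewrite in_itv/= => /andP[x1 x2].
  have [|y] := @rat_in_itvoo R (tnth s i) (tnth s i + b / 2); first by lra.
  rewrite in_itv/= => /andP[y1 y2].
  by exists (x, y); split.
exists [tuple p i | i < d].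
  by move=> i; rewrite tnth_mktuple in_itv/=; have [_ -> -> _] := Pp i.
move=> s' h; apply: (le_lt_trans (enorm_le_sum _)).
apply: (@le_lt_trans _ _ (\sum_(i < d) b)).
  apply: ler_sum => i _; rewrite !mxE.
  have := h i; rewrite tnth_mktuple in_itv/= => /andP[h1 h2].
  by have [h3 h4 h5 h6] := Pp i; rewrite ler_norml; apply/andP; split; lra.
rewrite sumr_const card_ord -mulr_natr /b -mulrA -[ltRHS]mulr1 ltr_pM2l//.
by rewrite mulrC ltr_pdivrMr// mul1r ltrDl.
Qed.

Lemma measurable_open (U : set (Borel L0)) :
  open (U : set (Omega L0)) -> measurable U.
Proof. by move=> oU; exact: sub_sigma_algebra. Qed.

Lemma phi_near s (L : Omega L0) (U : set (Omega L0)) : nbhs (phi (vec s) L) U ->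
  exists q, exists2 V : set (Omega L0), nbhs L V &
    box q s /\ forall s' L', box q s' -> V L' -> U (phi (vec s') L').
Proof.
rewrite {1}nbhsE/= => -[_ [[W oW <-] /= WL] WU].
have : nbhs (dshift (vec s) (val L)) W by exact: open_nbhs_nbhs.
move=> /shift_near[a a0 h].
have [q qs hq] := box_nbhs s a0.
exists q; exists (set_val @^-1` ball (set_val L) a).
  by apply: (@initial_continuous _ _ set_val); exact: nbhsx_ballx.
split => // s' L' qs' aL; apply: WU => /=.
by apply: h => //; exact: hq.
Qed.

Lemma measurable_phi :
  measurable_fun [set: Borel L0 * d.-tuple (measurableTypeR R)]
    (fun p => phi (vec p.2) p.1 : Borel L0).
Proof.
apply: (@measurability _ _ _ (Borel L0) _ _ (@open (Omega L0))) => //.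
move=> _ [U oU <-]; rewrite setTI.
pose W q : set (Omega L0) := 
  interior [set L | forall s, box q s -> U (phi (vec s) L)].
have -> : (fun p : Borel L0 * d.-tuple (measurableTypeR R) =>
      phi (vec p.2) p.1 : Borel L0) @^-1` U
    = \bigcup_q ((W q : set (Borel L0)) `*` box q).
  apply/seteqP; split => -[L s] /=.
    move=> UL; have [|q [V nV [qs h]]] := @phi_near s L U.
      exact: open_nbhs_nbhs.
    exists q => //; split => //=; rewrite /W /interior/=.
    by apply: filterS nV => L' VL' s' qs'; exact: h.
  by move=> [q _ [/= Wq qs]]; exact: (interior_subset Wq).
apply: countable_bigcupT_measurable => [|q]; first exact: countableP.
apply: measurableX; last exact: measurable_box.
by apply: measurable_open; exact: open_interior.
Qed.

Definition heat_kernel (t : R) (L : Borel L0) (A : set (Borel L0)) : \bar R :=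
  heat_semigroup t \1_A L.

Lemma measurable_phi1 (L : Borel L0) :
  measurable_fun [set: d.-tuple (measurableTypeR R)]
    (fun s => phi (vec s) L : Borel L0).
Proof.
exact: (measurable_fun_pair2 L measurable_phi).
Qed.

Lemma measurable_integrand (t : R) (A : set (Borel L0)) : measurable A ->
  measurable_fun [set: Borel L0 * d.-tuple (measurableTypeR R)]
    (fun p => (gauss t (vec p.2) * \1_A (phi (vec p.2) p.1))%:E).
Proof.
move=> mA; apply/measurable_EFinP; apply: measurable_funM.
  exact: (measurableT_comp (measurable_gauss t) measurable_snd).
have m1 : measurable_fun setT (\1_A : Borel L0 -> R) by exact: measurable_indic.
exact: (measurableT_comp m1 measurable_phi).
Qed.

Section heat_measure.
Variables (t : R) (L : Borel L0).

Let preim (A : set (Borel L0)) : set (d.-tuple (measurableTypeR R)) :=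
  (fun s => phi (vec s) L) @^-1` A.

Let heatE A : heat_kernel t L A =
  (\int[lebesgue d]_(s in preim A) (gauss t (vec s))%:E)%E.
Proof.
rewrite [RHS]integral_mkcond; apply: eq_integral => s _.
rewrite patchE indicE (_ : (s \in _) = (phi (vec s) L \in A)); last first.
  by apply/idP/idP; rewrite !inE.
by case: (_ \in _); rewrite ?mulr1 ?mulr0.
Qed.

Let heat0 : heat_kernel t L set0 = 0%E.
Proof. by rewrite heatE /preim preimage_set0 integral_set0. Qed.

Let heat_ge0 A : (0 <= heat_kernel t L A)%E.
Proof.
by rewrite heatE; apply: integral_ge0 => s _; rewrite lee_fin gauss_ge0.
Qed.

Let heat_sigma_additive : semi_sigma_additive (heat_kernel t L).
Proof.
move=> F mF tF mUF.
rewrite heatE /preim preimage_bigcup ge0_integral_bigcup//.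
- under eq_fun do under eq_bigr do rewrite heatE.
  apply: is_cvg_ereal_nneg_natsum => n _; rewrite -heatE; exact: heat_ge0.
- by move=> k; rewrite -[X in measurable X]setTI; exact: measurable_phi1.
- apply: measurable_funTS; apply/measurable_EFinP; exact: measurable_gauss.
- by move=> s _; rewrite lee_fin gauss_ge0.
- apply/trivIsetP => /= i j _ _ ij; rewrite -preimage_setI.
  by move/trivIsetP : tF => /(_ _ _ _ _ ij) ->//; rewrite preimage_set0.
Qed.

HB.instance Definition _ := isMeasure.Build _ _ _ (heat_kernel t L)
  heat0 heat_ge0 heat_sigma_additive.

End heat_measure.

Lemma measurable_heat t A : measurable A ->
  measurable_fun [set: Borel L0] ((heat_kernel t)^~ A).
Proof.
move=> mA.
have f0 (p : Borel L0 * d.-tuple (measurableTypeR R)) :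
    (0 <= (gauss t (vec p.2) * \1_A (phi (vec p.2) p.1))%:E)%E.
  by rewrite lee_fin mulr_ge0// gauss_ge0.
exact: (measurable_fun_fubini_tonelli_F (m2 := lebesgue d) _
  (measurable_integrand t mA) f0).
Qed.

(* [\int 1_A d(T_t^* nu) = \int T_t 1_A d nu]: the adjoint relation on
   indicator functions, which determines [T_t^* nu]. *)
Definition adjoint_semigroup (t : R)
    (nu : {finite_measure set (Borel L0) -> \bar R}) (A : set (Borel L0)) :
    \bar R :=
  (\int[nu]_L heat_semigroup t \1_A L)%E.

Section adjoint_measure.
Variables (t : R) (nu : {finite_measure set (Borel L0) -> \bar R}).

Let adjoint0 : adjoint_semigroup t nu set0 = 0%E.
Proof.
rewrite /adjoint_semigroup integral0_eq// => L _.
exact: (measure0 (heat_kernel t L)).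
Qed.

Let adjoint_ge0 A : (0 <= adjoint_semigroup t nu A)%E.
Proof.
by apply: integral_ge0 => L _; exact: (measure_ge0 (heat_kernel t L)).
Qed.

Let adjoint_sigma_additive : semi_sigma_additive (adjoint_semigroup t nu).
Proof.
move=> F mF tF mUF.
rewrite [X in _ --> X](_ : _ = (\sum_(n <oo) adjoint_semigroup t nu (F n))%E).
  by apply: is_cvg_ereal_nneg_natsum => n _; exact: adjoint_ge0.
rewrite /adjoint_semigroup -integral_nneseries//.
- apply: eq_integral => L _; apply/esym/cvg_lim => //.
  exact: (@measure_semi_sigma_additive _ _ _ (heat_kernel t L) F mF tF mUF).
- by move=> n; exact: measurable_heat.
- by move=> n L _; exact: (measure_ge0 (heat_kernel t L)).
Qed.

HB.instance Definition _ := isMeasure.Build _ _ _ (adjoint_semigroup t nu)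
  adjoint0 adjoint_ge0 adjoint_sigma_additive.

End adjoint_measure.

Lemma adjoint_dirac t (L : Borel L0) A : measurable A ->
  adjoint_semigroup t \d_L A = heat_kernel t L A.
Proof.
move=> mA; rewrite /adjoint_semigroup integral_dirac ?diracT ?mul1e//.
exact: (measurable_heat t mA).
Qed.

Definition translation_invariant (nu : probability (Borel L0) R) :=
  forall (t : 'rV[R]_d) (A : set (Borel L0)), measurable A ->
    nu ((phi t : Borel L0 -> Borel L0) @^-1` A) = nu A.

Definition uniquely_ergodic_with (mu : probability (Borel L0) R) :=
  translation_invariant mu /\
  forall nu : probability (Borel L0) R, translation_invariant nu ->
    forall A, measurable A -> nu A = mu A.

Definition semigroup_invariant (mu : probability (Borel L0) R) :=
  forall (f : Omega L0 -> R) (t : R), continuous f -> 0 < t ->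
    (\int[mu]_L heat_semigroup t f L = \int[mu]_L (f L)%:E)%E.

Definition weakly_converges
    (nu : R -> {measure set (Borel L0) -> \bar R})
    (mu : {measure set (Borel L0) -> \bar R}) :=
  forall g : Omega L0 -> R, continuous g ->
    (\int[nu t]_L (g L)%:E)%E @[t --> +oo] --> (\int[mu]_L (g L)%:E)%E.

End Heat.

(* Main.v *)
From HB Require Import structures.
Require Import Defs.
From mathcomp Require Import all_boot all_order all_algebra.
From mathcomp Require Import all_classical all_reals all_analysis.
From mathcomp Require Import measurable_realfun finmap ring lra.

Set Implicit Arguments.
Unset Strict Implicit.
Unset Printing Implicit Defensive.
Import Order.TTheory GRing.Theory Num.Theory.
Import numFieldNormedType.Exports.
Local Open Scope classical_set_scope.
Local Open Scope ring_scope.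

(** The proof is the Krylov-Bogolyubov argument. The heat kernels [T_t(L, .)]
    are probability measures on the compact space [Omega]. As [t] grows they
    become almost invariant under each fixed translation, so every limit
    point of the family at infinity is a translation invariant probability
    measure, and by unique ergodicity it is [mu]. A family in a compact space
    with a single limit point converges.

    - Compactness ([compact_Omega]). Finite local complexity leaves, up to
      translation, finitely many patches of a given radius, and the
      translation vectors are bounded. Along an ultrafilter on [Omega] the
      patch around the origin is therefore eventually constant and its
      position converges, which is convergence in the pattern metric.

    - Limit points ([ultra_weak_limit]). For an ultrafilter on the index set,
      the limits of the masses [nu_i(A)] always exist and form a finitely
      additive set function. Its values on closed sets form a content in the
      sense of Halmos, and Caratheodory's construction turns that content into
      a Borel probability measure [P] ([content_probability]). The mass
      [P(U)] of an open set is at most the limit of [nu_i(U)]; with the layer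
      cake formula this bounds the integral of a continuous function by the
      limit of its integrals, and applying the bound to [1 - g] as well gives
      equality. Since the construction is natural, a homeomorphism that
      asymptotically preserves the [nu_i] preserves [P].

    - Almost invariance ([heat_shift_le]). Write [g] for the Gaussian density
      of variance [t]. The parallelogram law gives
      [g(u) g(u - 2 s) e^{|s|^2 / t} = g(u - s)^2], so the chi-square
      distance between [g] and its translate by [s] is [e^{|s|^2 / t} - 1],
      which tends to [0]; only translation invariance of Lebesgue measure and
      the total mass of a Gaussian enter.

    Invariance of [mu] under the semigroup is Fubini's theorem: averaging a
    translation invariant integral over translations does not change it. *)

(** * From a content on closed sets to a Borel probability measure *)

Section Content.
Context {R : realType} {X : ptopologicalType}.

Local Open Scope ereal_scope.

Definition inner_content (lam : set X -> R) (U : set X) : \bar R :=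
  ereal_sup [set (lam K)%:E | K in [set K | closed K /\ K `<=` U]].

Definition outer_content (lam : set X -> R) (A : set X) : \bar R :=
  ereal_inf [set inner_content lam U | U in [set U | open U /\ A `<=` U]].

Local Close Scope ereal_scope.

Hypothesis cptX : compact [set: X].
Hypothesis normX : normal_space X.

Variable lam : set X -> R.
Hypothesis lam0 : lam set0 = 0.
Hypothesis lamT : lam setT = 1.
Hypothesis lam_le : forall K K', closed K -> closed K' -> K `<=` K' ->
  lam K <= lam K'.
Hypothesis lamU : forall K K', closed K -> closed K' ->
  lam (K `|` K') <= lam K + lam K'.
Hypothesis lam_disj : forall K K', closed K -> closed K' -> K `&` K' = set0 ->
  lam K + lam K' <= lam (K `|` K').

Local Open Scope ereal_scope.

Local Notation rho := (inner_content lam).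
Local Notation mu := (outer_content lam).

Let rho_ub K U : closed K -> K `<=` U -> (lam K)%:E <= rho U.
Proof. by move=> cK KU; apply: ereal_sup_ubound; exists K. Qed.

Let rho_ge0 U : 0 <= rho U.
Proof. by rewrite -[0%E]/(0%R%:E) -lam0; apply: rho_ub => //; exact: closed0. Qed.

Let rho_le U V : U `<=` V -> rho U <= rho V.
Proof.
move=> UV; apply: ge_ereal_sup => _ [K [cK KU] <-].
by apply: rho_ub => //; exact: subset_trans UV.
Qed.

Let rho_le_closed U K : closed K -> U `<=` K -> rho U <= (lam K)%:E.
Proof.
move=> cK UK; apply: ge_ereal_sup => _ [K' [cK' KU] <-].
by rewrite lee_fin lam_le//; exact: subset_trans UK.
Qed.

Let rhoT : rho setT = 1.
Proof.
apply/eqP; rewrite eq_le; apply/andP; split.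
  by rewrite -[1%E]/(1%R%:E) -lamT rho_le_closed//; exact: closedT.
by rewrite -[1%E]/(1%R%:E) -lamT rho_ub//; exact: closedT.
Qed.

Let rho_fin U : rho U \is a fin_num.
Proof.
rewrite ge0_fin_numE ?rho_ge0// (le_lt_trans (rho_le (subsetT U)))//.
by rewrite rhoT ltry.
Qed.

(** Normality cuts a closed subset of [U `|` V] into a closed subset of [U] and
    one of [V]. *)
Let rhoU U V : open U -> open V -> rho (U `|` V) <= rho U + rho V.
Proof.
move=> oU oV; apply: ge_ereal_sup => _ [K [cK KUV] <-].
have closedDo W : open W -> closed (K `\` W).
  by move=> oW; rewrite setDE; apply: closedI => //; exact: open_closedC.
have cU := closedDo _ oU; have cV := closedDo _ oV.
have [|A [B [oA oB UA VB AB]]] := (@normal_openP R X).1 normX _ _ cU cV.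
  by apply/seteqP; split => // x [[Kx nU] [_ nV]]; have [] := KUV _ Kx.
have cA := closedDo _ oA; have cB := closedDo _ oB.
apply: (@le_trans _ _ (lam (K `\` A) + lam (K `\` B))%:E).
  rewrite lee_fin; apply: le_trans (lamU cA cB); apply: lam_le => //.
    exact: closedU.
  move=> x Kx; have [Ax|nA] := pselect (A x); last by left.
  by right; split => // Bx; have : (A `&` B) x by []; rewrite AB.
rewrite EFinD; apply: leeD; apply: rho_ub => // x [Kx nx]; apply: contrapT => h.
  by apply/nx/UA.
by apply/nx/VB.
Qed.

Let rho_bigU (U : (set X)^nat) n : (forall i, open (U i)) ->
  rho (\bigcup_(i in `I_n) U i) <= \sum_(i < n) rho (U i).
Proof.
move=> oU; elim: n => [|n ih].
  rewrite big_ord0 II0 bigcup_set0 -[0%E]/(0%R%:E) -lam0.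
  by apply: rho_le_closed => //; exact: closed0.
rewrite big_ord_recr/= IIS bigcup_setU bigcup_set1.
apply: (le_trans (rhoU _ _)) => //; first exact: bigcup_open.
exact: leeD.
Qed.

(** Compactness reduces a countable cover of a closed set to a finite one. *)
Let rho_bigcup (U : (set X)^nat) : (forall i, open (U i)) ->
  rho (\bigcup_i U i) <= \sum_(i <oo) rho (U i).
Proof.
move=> oU; apply: ge_ereal_sup => _ [K [cK KU] <-].
have := subclosed_compact cK cptX (@subsetT _ K).
rewrite compact_cover => /(_ nat setT U (fun i _ => oU i) KU) [D _ KD].
pose n := (\max_(i <- D) i).+1.
have KI : K `<=` \bigcup_(i in `I_n) U i.
  move=> x /KD [i Di Uix]; exists i => //=.
  by rewrite /n ltnS; apply: (@leq_bigmax_seq _ _ xpredT id).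
apply: (le_trans (rho_ub cK KI)); apply: (le_trans (rho_bigU n oU)).
rewrite -(big_mkord xpredT (fun i => rho (U i))).
exact: nneseries_lim_ge.
Qed.

Let mu_open U : open U -> mu U = rho U.
Proof.
move=> oU; apply/eqP; rewrite eq_le; apply/andP; split.
  by apply: ereal_inf_lbound; exists U => //; split.
by apply: le_ereal_inf_tmp => _ [V [oV UV] <-]; exact: rho_le.
Qed.

Let mu_ge0 A : 0 <= mu A.
Proof. by apply: le_ereal_inf_tmp => _ [V _ <-]. Qed.

Let mu0 : mu set0 = 0.
Proof.
apply/eqP; rewrite eq_le mu_ge0 andbT mu_open; last exact: open0.
by rewrite -[0%E]/(0%R%:E) -lam0 rho_le_closed//; exact: closed0.
Qed.

Let mu_le : {homo mu : A B / A `<=` B >-> A <= B}.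
Proof.
move=> A B AB; apply: le_ereal_inf_tmp => _ [V [oV BV] <-].
by apply: ereal_inf_lbound; exists V => //; split => //; exact: subset_trans BV.
Qed.

Let mu_fin A : mu A \is a fin_num.
Proof.
rewrite ge0_fin_numE ?mu_ge0// (le_lt_trans (mu_le (@subsetT _ A)))//.
by rewrite mu_open ?rhoT ?ltry//; exact: openT.
Qed.

Let mu_approx A (e : R) : (0 < e)%R ->
  exists U, [/\ open U, A `<=` U & rho U <= mu A + e%:E].
Proof.
move=> e0; have [_ [U [oU AU] <-] h] := lb_ereal_inf_adherent e0 (mu_fin A).
by exists U; split => //; exact: ltW.
Qed.

Let mu_sigma_subadditive : sigma_subadditive mu.
Proof.
move=> A; apply/lee_addgt0Pr => e e0.
apply: (le_trans _ (epsilon_trick _ _ (ltW e0))) => //.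
have /choice[U hU] : forall n, exists U, [/\ open U, A n `<=` U &
    rho U <= mu (A n) + (e / (2 ^ n.+1)%:R)%:E].
  by move=> n; apply: mu_approx; rewrite divr_gt0// ltr0n expn_gt0.
apply: (@le_trans _ _ (mu (\bigcup_i U i))).
  by apply: mu_le; apply: subset_bigcup => n _; have [] := hU n.
rewrite mu_open; last by apply: bigcup_open => n _; have [] := hU n.
apply: (le_trans (rho_bigcup _)); first by move=> n; have [] := hU n.
by apply: lee_nneseries => // n _; have [] := hU n.
Qed.

Let out : {outer_measure set X -> \bar R} :=
  HB.pack mu (isOuterMeasure.Build R X mu mu0 mu_ge0 mu_le mu_sigma_subadditive).

(** Take an open [V] around [E] that is almost as light, and split off a closed
    part [K] of [V `&` U] that is almost as heavy: the rest [V `\` K] is open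
    and covers [E `\` U]. *)
Let open_caratheodory U : open U -> out.-caratheodory U.
Proof.
move=> oU; apply: le_caratheodory_measurable => E.
apply/lee_addgt0Pr => e e0.
have e3 : (0 < e / 3)%R by rewrite divr_gt0.
have [V [oV EV Ve]] := mu_approx E e3.
have sup_approx W : exists K, [/\ closed K, K `<=` W &
    rho W <= (lam K)%:E + (e / 3)%:E].
  have [_ [K [cK KW] <-] h] := ub_ereal_sup_adherent e3 (rho_fin W).
  by exists K; split => //; rewrite -leeBlDr//; exact: ltW.
have [K [cK KVU Ke]] := sup_approx (V `&` U).
have oVK : open (V `\` K) by rewrite setDE; apply: openI => //; exact: closed_openC.
have [K' [cK' KVK Ke']] := sup_approx (V `\` K).
apply: (@le_trans _ _ ((lam K)%:E + (e / 3)%:E + ((lam K')%:E + (e / 3)%:E))).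
  apply: leeD.
    apply: le_trans Ke; rewrite -mu_open; last exact: openI.
    by apply: mu_le => x [Ex Ux]; split => //; exact: EV.
  apply: le_trans Ke'; rewrite -mu_open//.
  by apply: mu_le => x [Ex nUx]; split; [exact: EV|move/KVU => -[]].
apply: (@le_trans _ _ (rho V + (e / 3 + e / 3)%:E)).
  rewrite addeACA [in leRHS]EFinD leeD// -EFinD.
  apply: (@le_trans _ _ (lam (K `|` K'))%:E).
    rewrite lee_fin lam_disj//; apply/seteqP; split => // x [Kx /KVK[_]].
    exact.
  by apply: rho_ub; [exact: closedU|move=> x [/KVU[]|/KVK[]]].
apply: (@le_trans _ _ (mu E + (e / 3)%:E + (e / 3 + e / 3)%:E)); first exact: leeD.
by rewrite -addeA leeD2l// -EFinD lee_fin; lra.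
Qed.

Local Notation BX := (g_sigma_algebraType (@open X)).

Let borel_caratheodory (A : set BX) : measurable A -> out.-cara.-measurable A.
Proof.
apply: smallest_sub; first last.
  by move=> U oU; exact: open_caratheodory.
split.
- exact: (@measurable0 _ (caratheodory_type out)).
- move=> B mB; rewrite setTD.
  exact: (@measurableC _ (caratheodory_type out)).
- by move=> F mF; apply: (@bigcupT_measurable _ (caratheodory_type out)).
Qed.

Let mu_sigma_additive : semi_sigma_additive (mu : set BX -> \bar R).
Proof.
move=> F mF tF mUF.
apply: (@caratheodory_measure_sigma_additive R X out F) => //.
  by move=> i; exact: borel_caratheodory.
exact: borel_caratheodory.
Qed.

(** The explicit formula for [P] on all sets, and not only on open ones, is
    what makes invariance under homeomorphisms immediate. *)
Lemma content_probability : exists P : probability BX R,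
  (forall A, P A = outer_content lam A) /\
  (forall U, open U -> P U = inner_content lam U).
Proof.
pose m : {measure set BX -> \bar R} :=
  HB.pack (mu : set BX -> \bar R) (isMeasure.Build _ _ _ (mu : set BX -> \bar R)
    mu0 mu_ge0 mu_sigma_additive).
have mT : m setT = 1 by rewrite [LHS]mu_open ?rhoT//; exact: openT.
pose P : probability BX R :=
  HB.pack (mu : set BX -> \bar R) (Measure.on m)
   (Measure_isProbability.Build _ _ _ m mT).
by exists P; split => // U oU; exact: mu_open.
Qed.

End Content.

(** * Limits along ultrafilters *)

Section Ultra.

Lemma ultra_fmap {T U : Type} (f : T -> U) (F : set_system T) :
  UltraFilter F -> UltraFilter (f @ F).
Proof.
move=> FU; split=> [|G GF sFG]; first exact: fmap_proper_filter.
rewrite eqEsubset; split => // A GA.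
have [//|nA] := in_ultra_setVsetC (f @^-1` A) FU.
have /(filterI GA) : G (~` A) by exact: sFG.
by rewrite setICr => /filter_ex[].
Qed.

Lemma ultra_compact_cvg {T : Type} {Y : topologicalType} (f : T -> Y) (K : set Y)
    (F : set_system T) : UltraFilter F -> compact K -> F (f @^-1` K) ->
  exists2 p, K p & f @ F --> p.
Proof.
move=> FU + FK; rewrite compact_ultra => /(_ (f @ F)).
by move=> /(_ (ultra_fmap f FU) FK)[p [Kp fp]]; exists p.
Qed.

Lemma ultra_itv_cvg {R : realType} {T : Type} (f : T -> R) (a b : R)
    (F : set_system T) : UltraFilter F -> (\forall x \near F, a <= f x <= b) ->
  cvg (f @ F).
Proof.
move=> FU Fab; have [|p _ fp] := ultra_compact_cvg (f := f) FU (@segment_compact R a b).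
  by apply: filterS Fab => x; rewrite /= in_itv.
by apply/cvg_ex; exists p.
Qed.

(** Otherwise, for some neighbourhood [U] of [p], the filter [F] could be
    restricted to the points that [f] maps outside [U], and an ultrafilter
    finer than that restriction would contradict the hypothesis. *)
Lemma cvg_ultra {T : Type} {Y : topologicalType} (f : T -> Y) (p : Y)
    (F : set_system T) : ProperFilter F ->
  (forall G, UltraFilter G -> F `<=` G -> f @ G --> p) -> f @ F --> p.
Proof.
move=> FF h U pU; apply: contrapT => nFU.
have WF : ProperFilter (within (~` (f @^-1` U)) F).
  apply: Build_ProperFilter; rewrite /within /= => FU.
  by apply: nFU; apply: filterS FU => x h'; apply: contrapT.
have [G [GU WG]] := ultraFilterLemma WF.
have FG : F `<=` G by apply: subset_trans WG; exact: cvg_within.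
have GfU : G (f @^-1` U) by exact: h GU FG _ pU.
have : G (~` (f @^-1` U)) by apply: WG; rewrite /within/=; exact: nearW.
by move=> /(filterI GfU); rewrite setICr => /filter_ex[].
Qed.

End Ultra.

(** * Integrals of continuous functions by layers *)

Section LayerCake.
Context {R : realType} {X : ptopologicalType}.
Local Notation BX := (g_sigma_algebraType (@open X)).
Implicit Types (m : {measure set BX -> \bar R}) (g : X -> R).

Lemma open_borel (U : set BX) : open (U : set X) -> measurable U.
Proof. by move=> oU; exact: sub_sigma_algebra. Qed.

Lemma closed_borel (K : set BX) : closed (K : set X) -> measurable K.
Proof.
move=> cK; rewrite -[K]setCK; apply: measurableC; apply: open_borel.
exact: closed_openC.
Qed.

Lemma open_superlevel g r : continuous g -> open [set x : X | r < g x].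
Proof. by move=> /continuousP cg; apply: (cg [set y | r < y]); exact: open_gt. Qed.

Lemma continuous_measurable g : continuous g -> measurable_fun [set: BX] g.
Proof.
move=> cg; apply: (measurability (RGenOInfty.G (R:=R))).
  exact: RGenOInfty.measurableE.
move=> _ [_ [x ->] <-]; rewrite setTI; apply: open_borel.
by rewrite set_itvoy; exact: open_superlevel.
Qed.

Lemma continuous_borel (h : X -> X) : continuous h ->
  measurable_fun [set: BX] (h : BX -> BX).
Proof.
move=> ch; apply: (@measurability _ _ BX BX setT h (@open X)) => // _ [U oU <-].
by rewrite setTI; apply: open_borel; move/continuousP : ch => /(_ U oU).
Qed.

Lemma continuous_compact_bounded g : compact [set: X] -> continuous g ->
  exists2 M, 0 < M & forall x, `|g x| <= M.
Proof.
move=> cptX cg; have /compact_bounded[M [_ Mg]] : compact (range g).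
  by apply: continuous_compact => //; exact: continuous_subspaceT.
exists (`|M| + 1); first by rewrite ltr_wpDl.
by move=> x; apply: Mg; [rewrite ltr_pwDr// ler_norm|exists x].
Qed.

(** The layer cake sum of mesh [1 / N] for the integral of [g]. For continuous [g] it
    involves only the masses of open sets. *)
Definition layer_avg (N : nat) g m : R :=
  N%:R^-1 * \sum_(k < N) fine (m [set x : BX | k%:R / N%:R < g x]).

(** The sum counts the [k < N] with [k < N * g x]: it is [N * g x] rounded up
    to an integer and divided by [N]. *)
Let layer_sum g N x : (0 < N)%N -> 0 <= g x <= 1 ->
  g x <= \sum_(k < N) N%:R^-1 * \1_[set y | k%:R / N%:R < g y] x <= g x + N%:R^-1.
Proof.
move=> N0 /andP[g0 g1].
have N0' : 0 < N%:R :> R by rewrite ltr0n.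
pose c := N%:R * g x.
have cN : c <= N%:R by rewrite /c ger_pMr.
have c0 : 0 <= c by rewrite mulr_ge0// ltW.
pose S n := \sum_(k < n) (k%:R < c)%R%:R : R.
(* For an arbitrary number of terms: every term is 1 as long as [n <= c]. *)
have E n : (n%:R <= c -> S n = n%:R) /\ (c <= n%:R -> c <= S n <= c + 1).
  elim: n => [|n [ih1 ih2]].
    by rewrite /S big_ord0; split => // ?; lra.
  have -> : S n.+1 = S n + (n%:R < c)%R%:R by rewrite /S big_ord_recr.
  rewrite -natr1; have [nc|cn] := ltP n%:R c.
    rewrite (ih1 (ltW nc)) /=; split => // cn.
    by apply/andP; split => //; rewrite lerD2r ltW.
  rewrite addr0; split => [|_]; last exact: ih2.
  by move: cn; lra.
have {E} [_ /(_ cN)] := E N.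
have -> : \sum_(k < N) N%:R^-1 * \1_[set y | k%:R / N%:R < g y] x = N%:R^-1 * S N.
  rewrite mulr_sumr; apply: eq_bigr => k _; rewrite indicE.
  have -> : (k%:R < c)%R = (k%:R / N%:R < g x)%R by rewrite ltr_pdivrMr// mulrC.
  congr (_ * _%:R); congr nat_of_bool.
  by apply/idP/idP; [move/set_mem|move=> h; exact/mem_set].
have -> : g x = N%:R^-1 * c by rewrite /c mulKf// gt_eqF.
move=> /andP[h1 h2]; rewrite -[X in _ <= _ + X]mulr1 -mulrDr.
by rewrite !ler_pM2l ?invr_gt0// h1.
Qed.

Lemma layer_avg_itv g m N : continuous g -> (forall x, 0 <= g x <= 1) ->
  m setT = 1%E -> (0 < N)%N ->
  (\int[m]_x (g x)%:E <= (layer_avg N g m)%:E <=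
   \int[m]_x (g x)%:E + N%:R^-1%:E)%E.
Proof.
move=> cg g01 m1 N0.
have mg : measurable_fun [set: BX] (fun x => (g x)%:E).
  by apply/measurable_EFinP; exact: continuous_measurable.
have mU k : measurable ([set x : BX | k%:R / N%:R < g x]).
  by apply: open_borel; exact: open_superlevel.
pose s (x : BX) := \sum_(k < N) N%:R^-1 * \1_[set y | k%:R / N%:R < g y] x : R.
have ms : measurable_fun [set: BX] (fun x => (s x)%:E).
  apply/measurable_EFinP; apply: measurable_sum => k.
  by apply: measurable_funM => //; exact: measurable_indic.
have g0 x : (0 <= (g x)%:E)%E by rewrite lee_fin; case/andP: (g01 x).
have gs x : (g x <= s x <= g x + N%:R^-1)%R by exact: layer_sum.
have -> : (layer_avg N g m)%:E = (\int[m]_x (s x)%:E)%E.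
  under [RHS]eq_integral do rewrite -sumEFin.
  rewrite ge0_integral_sum//; last first.
    move=> k; apply/measurable_EFinP.
    by apply: measurable_funM => //; exact: measurable_indic.
  rewrite /layer_avg mulr_sumr -sumEFin; apply: eq_bigr => k _.
  under eq_integral do rewrite EFinM.
  rewrite ge0_integralZl//; last first.
    by apply/measurable_EFinP; exact: measurable_indic.
  rewrite integral_indic// setIT EFinM fineK// ge0_fin_numE//.
  apply: (@le_lt_trans _ _ (m setT)); last by rewrite m1 ltry.
  by apply: le_measure => //; apply: mem_set.
have -> : (\int[m]_x (g x)%:E + N%:R^-1%:E = \int[m]_x (g x + N%:R^-1)%:E)%E.
  under [RHS]eq_integral do rewrite EFinD.
  rewrite ge0_integralD//.
  by rewrite integral_cst// m1 mule1.
apply/andP; split; apply: ge0_le_integral => //.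
- by move=> x _; rewrite lee_fin; case/andP: (gs x).
- by move=> x _; apply: le_trans (g0 x) _; rewrite lee_fin; case/andP: (gs x).
- by apply/measurable_EFinP; apply: measurable_funD => //; apply/measurable_EFinP.
- by move=> x _; rewrite lee_fin; case/andP: (gs x).
Qed.

Lemma integral_affine m g (a b : R) : continuous g ->
  (forall x, 0 <= g x <= 1) -> m setT = 1%E ->
  (\int[m]_x (a * g x + b)%:E)%E = (a * fine (\int[m]_x (g x)%:E) + b)%:E.
Proof.
move=> cg g01 m1.
have ig : m.-integrable setT (fun x : BX => (g x)%:E).
  apply: measurable_bounded_integrable => //; first by rewrite m1 ltry.
    exact: continuous_measurable.
  exists 1; split => // c c1 x _ /=; case/andP: (g01 x) => g0 g1.
  by rewrite ger0_norm// (le_trans g1)// ltW.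
have ib : m.-integrable setT (fun x : BX => b%:E).
  apply: measurable_bounded_integrable => //; first by rewrite m1 ltry.
  exists `|b|; split; first by rewrite num_real.
  by move=> c bc x _ /=; exact: ltW.
under eq_integral do rewrite EFinD EFinM.
rewrite integralD//; last exact: integrableZl.
rewrite integralZl// integral_cst// m1 mule1 EFinD EFinM fineK//.
exact: integral_fune_fin_num.
Qed.

End LayerCake.

(** * Limit points of a family of probability measures *)

Section WeakLimit.
Context {R : realType} {X : ptopologicalType}.
Hypothesis cptX : compact [set: X].
Hypothesis normX : normal_space X.
Local Notation BX := (g_sigma_algebraType (@open X)).
Context {I : Type} {F : set_system I} {FU : UltraFilter F}.
Variable nu : I -> {measure set BX -> \bar R}.
Hypothesis nu1 : \forall i \near F, nu i setT = 1%E.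

(** Only finitely additive in general: in the limit, mass may move from an open set to
    its boundary. *)
Let lam (A : set X) : R := lim (fine (nu i A) @[i --> F]).

Let nu_itv (A : set BX) : measurable A ->
  \forall i \near F, (0 <= nu i A <= 1)%E.
Proof.
move=> mA; apply: filterS nu1 => i i1; rewrite measure_ge0/= -i1.
by apply: le_measure => //; exact: mem_set.
Qed.

Let nu_fin (A : set BX) : measurable A ->
  \forall i \near F, nu i A \is a fin_num.
Proof.
move=> mA; apply: filterS (nu_itv mA) => i /andP[h0 h1].
by rewrite ge0_fin_numE// (le_lt_trans h1)// ltry.
Qed.

Let lam_cvg (A : set BX) : measurable A -> fine (nu i A) @[i --> F] --> lam A.
Proof.
move=> mA; apply: (ultra_itv_cvg (a := 0) (b := 1)).
apply: filterS2 (nu_itv mA) (nu_fin mA) => i.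
by move=> + h; rewrite -{1 2}(fineK h) !lee_fin.
Qed.

Let lam0 : lam set0 = 0.
Proof. by rewrite /lam; under eq_fun do rewrite measure0/=; exact: lim_cst. Qed.

Let lamT : lam setT = 1.
Proof.
apply/cvg_lim => //; apply: (cvg_trans _ (@cvg_cst _ (1 : R) _ F _)).
by apply: near_eq_cvg; apply: filterS nu1 => i ->.
Qed.

Let lam_near_le (f g : I -> R) (a b : R) : f @ F --> a -> g @ F --> b ->
  (\forall i \near F, f i <= g i) -> a <= b.
Proof.
move=> fa gb fg; have gfab : (g - f) @ F --> b - a by exact: cvgB.
rewrite -subr_ge0 -(cvg_lim _ gfab)//; apply: limr_ge.
  by apply/cvg_ex; exists (b - a).
by apply: filterS fg => i; rewrite /= subr_ge0.
Qed.

Let lam_le (A B : set BX) : measurable A -> measurable B -> A `<=` B ->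
  lam A <= lam B.
Proof.
move=> mA mB AB; apply: lam_near_le (lam_cvg mA) (lam_cvg mB) _.
apply: filterS2 (nu_fin mA) (nu_fin mB) => i fA fB.
by apply: fine_le => //; apply: le_measure => //; exact: mem_set.
Qed.

Let lamU (A B : set BX) : measurable A -> measurable B ->
  lam (A `|` B) <= lam A + lam B.
Proof.
move=> mA mB.
apply: lam_near_le (lam_cvg (measurableU _ _ mA mB))
  (cvgD (lam_cvg mA) (lam_cvg mB)) _.
have fAB := nu_fin (measurableU _ _ mA mB).
apply: filterS3 (nu_fin mA) (nu_fin mB) fAB => i fA fB {}fAB.
change (fine (nu i (A `|` B)) <= fine (nu i A) + fine (nu i B)).
by rewrite -fineD// fine_le// ?fin_numD ?fA//; exact: measureU2.
Qed.

Let lam_disj (A B : set BX) : measurable A -> measurable B -> A `&` B = set0 ->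
  lam A + lam B <= lam (A `|` B).
Proof.
move=> mA mB AB.
apply: lam_near_le (cvgD (lam_cvg mA) (lam_cvg mB))
  (lam_cvg (measurableU _ _ mA mB)) _.
apply: filterS2 (nu_fin mA) (nu_fin mB) => i fA fB.
change (fine (nu i A) + fine (nu i B) <= fine (nu i (A `|` B))).
by rewrite -fineD// measureU.
Qed.

Let inner_homeo (h k : X -> X) : continuous k -> cancel h k -> cancel k h ->
  (forall A : set BX, measurable A -> lam (k @^-1` A) = lam A) ->
  forall U, (inner_content lam (h @^-1` U) <= inner_content lam U)%E.
Proof.
move=> ck hk kh lamk U; apply: ge_ereal_sup => _ [K [cK KU] <-].
have ckK : closed (k @^-1` K) by apply: closed_comp.
apply: ereal_sup_ubound; exists (k @^-1` K); last first.
  by congr EFin; apply: lamk; exact: closed_borel.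
by split => // x Kx; rewrite -(kh x); exact: KU.
Qed.

Let outer_homeo (h k : X -> X) : continuous h -> continuous k ->
  cancel h k -> cancel k h ->
  (forall A : set BX, measurable A -> lam (k @^-1` A) = lam A) ->
  forall A, (outer_content lam (h @^-1` A) <= outer_content lam A)%E.
Proof.
move=> ch ck hk kh lamk A; apply: le_ereal_inf_tmp => _ [U [oU AU] <-].
apply: ge_ereal_inf; exists (inner_content lam (h @^-1` U)); last first.
  exact: (inner_homeo (k := k)).
exists (h @^-1` U) => //; split; last by move=> x; exact: AU.
by move/continuousP : ch; exact.
Qed.

Let lam_open (P : probability BX R) (U : set BX) : open (U : set X) ->
  P U = inner_content lam U -> fine (P U) <= lam U.
Proof.
move=> oU PU; rewrite -lee_fin fineK ?fin_num_measure ?PU//; last exact: open_borel.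
apply: ge_ereal_sup => _ [K [cK KU] <-].
by rewrite lee_fin; apply: lam_le => //; [exact: closed_borel|exact: open_borel].
Qed.

(** One half of the portmanteau theorem: integrate by layers and use that open
    sets lose mass in the limit. *)
Let unit_integral_le (P : probability BX R) (g : X -> R) (a : R) :
  (forall U, open U -> P U = inner_content lam U) ->
  continuous g -> (forall x, 0 <= g x <= 1) ->
  fine (\int[nu i]_x (g x)%:E) @[i --> F] --> a -> (\int[P]_x (g x)%:E <= a%:E)%E.
Proof.
move=> Plam cg g01 ga; apply/lee_addgt0Pr => e e0.
have [N Ne] : exists N, N.+1%:R^-1 < e.
  by have [k] := ltr_add_invr e0; rewrite add0r; exists k.
pose A k : set BX := [set x | k%:R / N.+1%:R < g x].
have oA k : open (A k : set X) by exact: open_superlevel.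
have mA k : measurable (A k) by exact: open_borel.
have /andP[Ple _] := layer_avg_itv (m := P) cg g01 (probability_setT P) (ltn0Sn N).
apply: (le_trans Ple); rewrite -EFinD lee_fin.
apply: (@le_trans _ _ (N.+1%:R^-1 * \sum_(k < N.+1) lam (A k))).
  rewrite ler_pM2l ?invr_gt0//; apply: ler_sum => k _.
  exact: lam_open (oA k) (Plam _ (oA k)).
have nuA : layer_avg N.+1 g (nu i) @[i --> F] -->
    N.+1%:R^-1 * \sum_(k < N.+1) lam (A k).
  apply: cvgM; first exact: cvg_cst.
  by apply: cvg_big => [|k _]; [exact: add_continuous|exact: (lam_cvg (mA k))].
apply: (@le_trans _ _ (a + N.+1%:R^-1)); last by rewrite lerD2l ltW.
apply: lam_near_le nuA (cvgD ga (cvg_cst _)) _.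
apply: filterS nu1 => i i1.
have /andP[h0 h1] := layer_avg_itv (m := nu i) cg g01 i1 (ltn0Sn N).
have fi : (\int[nu i]_x (g x)%:E)%E \is a fin_num.
  rewrite ge0_fin_numE ?(le_lt_trans h0) ?ltry//.
  by apply: integral_ge0 => x _; rewrite lee_fin; case/andP: (g01 x).
by rewrite -lee_fin EFinD fineK.
Qed.

(** The bound of [unit_integral_le] for [u] and for [1 - u] forces equality; a
    continuous function on a compact space is an affine image of such a [u]. *)
Let cvg_integral (P : probability BX R) (g : X -> R) :
  (forall U, open U -> P U = inner_content lam U) -> continuous g ->
  (\int[nu i]_x (g x)%:E)%E @[i --> F] --> (\int[P]_x (g x)%:E)%E.
Proof.
move=> Plam cg.
have [M M0 gM] := continuous_compact_bounded cptX cg.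
pose u x := (2 * M)^-1 * g x + 2^-1.
have cu : continuous u.
  move=> x; apply: cvgD; last exact: cvg_cst.
  by apply: cvgM; [exact: cvg_cst|exact: cg].
have u01 x : 0 <= u x <= 1.
  have -> : u x = (g x + M) / (2 * M) by rewrite /u; field; rewrite gt_eqF.
  have := gM x; rewrite ler_norml => /andP[h1 h2].
  have M20 : 0 < 2 * M by rewrite mulr_gt0.
  by rewrite ler_pdivlMr// ler_pdivrMr//; apply/andP; split; move: h1 h2; lra.
have guE : g = (fun x => 2 * M * u x - M).
  by apply/funext => x; rewrite /u; field; rewrite gt_eqF.
have /cvg_ex[/= a ua] : cvg (fine (\int[nu i]_x (u x)%:E) @[i --> F]).
  apply: (ultra_itv_cvg (a := 0) (b := 1)); apply: filterS nu1 => i i1.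
  have le1 : (\int[nu i]_x (u x)%:E <= 1)%E.
    have <- : (\int[nu i]_x (cst 1%E x) = 1)%E by rewrite integral_cst// i1 mule1.
    apply: ge0_le_integral => //.
    - by move=> x _; rewrite lee_fin; case/andP: (u01 x).
    - by apply/measurable_EFinP; exact: continuous_measurable.
    - by move=> x _; rewrite lee_fin; case/andP: (u01 x).
  have ge0 : (0 <= \int[nu i]_x (u x)%:E)%E.
    by apply: integral_ge0 => x _; rewrite lee_fin; case/andP: (u01 x).
  have fin : (\int[nu i]_x (u x)%:E)%E \is a fin_num.
    by rewrite ge0_fin_numE// (le_lt_trans le1)// ltry.
  by rewrite -!lee_fin fineK// ge0.
have affine (m : {measure set BX -> \bar R}) : m setT = 1%E ->
    (\int[m]_x (g x)%:E)%E = (2 * M * fine (\int[m]_x (u x)%:E) - M)%:E.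
  by move=> m1; rewrite {1}guE integral_affine.
have Pa : fine (\int[P]_x (u x)%:E) = a.
  have PE b c := integral_affine b c cu u01 (probability_setT P).
  have E1 := PE 1 0; have E2 := PE (-1) 1.
  apply/eqP; rewrite eq_le; apply/andP; split.
    have := unit_integral_le Plam cu u01 ua.
    have -> : (\int[P]_x (u x)%:E = (fine (\int[P]_x (u x)%:E))%:E)%E.
      by rewrite -[in RHS](addr0 (fine _)) -{1}[fine _]mul1r -E1;
        apply: eq_integral => x _; rewrite mul1r addr0.
    by rewrite lee_fin.
  have cu' : continuous (fun x => -1 * u x + 1).
    move=> x; apply: cvgD; last exact: cvg_cst.
    by apply: cvgM; [exact: cvg_cst|exact: cu].
  have u01' x : 0 <= -1 * u x + 1 <= 1 by move: (u01 x); lra.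
  have := unit_integral_le (a := 1 - a) Plam cu' u01'.
  rewrite E2 lee_fin.
  suff h : fine (\int[nu i]_x (-1 * u x + 1)%:E) @[i --> F] --> 1 - a.
    by move=> /(_ h); lra.
  rewrite -[- a]mulN1r addrC.
  have h : -1 * fine (\int[nu i]_x (u x)%:E) + 1 @[i --> F] --> -1 * a + 1.
    apply: cvgD; last exact: cvg_cst.
    by apply: cvgM => //; exact: cvg_cst.
  apply: (cvg_trans _ h); apply: near_eq_cvg; apply: filterS nu1 => i i1.
  by rewrite (integral_affine (-1) 1 cu u01 i1).
rewrite (affine P (probability_setT P)) Pa.
have h : (2 * M * fine (\int[nu i]_x (u x)%:E) - M)%:E @[i --> F] -->
    (2 * M * a - M)%:E.
  apply: cvg_EFin; first exact: nearW.
  apply: cvgD; last exact: cvg_cst.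
  by apply: cvgM => //; exact: cvg_cst.
apply: (cvg_trans _ h); apply: near_eq_cvg; apply: filterS nu1 => i i1.
by rewrite affine.
Qed.

(** Weak compactness of probability measures on a compact normal space, with
    the additional information that asymptotic symmetries become symmetries of
    the limit. *)
Lemma ultra_weak_limit : exists P : probability BX R,
  (forall h k : X -> X, continuous h -> continuous k ->
    cancel h k -> cancel k h ->
    (forall A : set BX, measurable A ->
      fine (nu i (h @^-1` A)) - fine (nu i A) @[i --> F] --> 0) ->
    forall A : set BX, P (h @^-1` A) = P A) /\
  (forall g : X -> R, continuous g ->
    (\int[nu i]_x (g x)%:E)%E @[i --> F] --> (\int[P]_x (g x)%:E)%E).
Proof.
have lec K K' : closed K -> closed K' -> K `<=` K' -> lam K <= lam K'.
  by move=> cK cK'; apply: lam_le; exact: closed_borel.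
have Uc K K' : closed K -> closed K' -> lam (K `|` K') <= lam K + lam K'.
  by move=> cK cK'; apply: lamU; exact: closed_borel.
have disjc K K' : closed K -> closed K' -> K `&` K' = set0 ->
    lam K + lam K' <= lam (K `|` K').
  by move=> cK cK'; apply: lam_disj; exact: closed_borel.
have [P [Pout Pin]] := content_probability cptX normX lam0 lamT lec Uc disjc.
exists P; split => [h k ch ck hk kh h0 A|g cg]; last exact: cvg_integral.
have mpre (f : X -> X) (B : set BX) : continuous f -> measurable B ->
    measurable (f @^-1` B : set BX).
  by move=> cf mB; rewrite -[X in measurable X]setTI; exact: continuous_borel.
have lamh (B : set BX) : measurable B -> lam (h @^-1` B) = lam B.
  move=> mB; apply/eqP; rewrite -subr_eq0; apply/eqP.
  have h1 : fine (nu i (h @^-1` B)) - fine (nu i B) @[i --> F] -->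
      lam (h @^-1` B) - lam B.
    by apply: cvgB; apply: lam_cvg => //; exact: mpre.
  by rewrite -(cvg_lim _ h1)//; apply/cvg_lim => //; exact: h0.
have lamk (B : set BX) : measurable B -> lam (k @^-1` B) = lam B.
  move=> mB; rewrite -lamh; last exact: mpre.
  by rewrite -comp_preimage (_ : k \o h = id)//; apply/funext => x /=.
rewrite !Pout; apply/eqP; rewrite eq_le (outer_homeo ch ck)//=.
have -> : outer_content lam A = outer_content lam (k @^-1` (h @^-1` A)).
  by rewrite -comp_preimage (_ : h \o k = id)//; apply/funext => x /=.
exact: (outer_homeo (h := k) (k := h)).
Qed.

End WeakLimit.

(** * Compactness of the pattern space *)

Section Compactness.
Context {R : realType} {d : nat} (L0 : delone_set R d).
Local Notation pts := (@delone_val R d).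
Implicit Types (x y z s t : 'rV[R]_d) (L : delone_set R d).

(** Every pattern of [Omega] agrees, near any point and up to a translation, with
    some part of [L0]: this transfers local properties from [L0] to [Omega]. *)
Lemma pattern_patch L (r : R) x : pattern_set L0 L ->
  exists y, forall z, enorm z < r -> (pts L (x + z) <-> pts L0 (y + z)).
Proof.
move=> LO; pose r1 := `|r| + enorm x + 1.
have r10 : 0 < r1 by rewrite ltr_wpDl// addr_ge0// enorm_ge0.
pose e := Num.min r1^-1 (Num.min 2^-1 (Num.sqrt 2)^-1) : R.
have e0 : 0 < e by rewrite !lt_min !invr_gt0 r10 sqrtr_gt0/= !ltr0n.
have [_ [[t _ <-]]] := LO _ (nbhsx_ballx L e e0).
rewrite ball_deloneE => /rho_agree[|e' [e'0 e'e [s [u []]]]].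
  by rewrite !ge_min lexx !orbT.
rewrite !eball0 => se ue E; exists (x - s + u + t) => z zr.
have we : enorm (x + z - s) < e'^-1.
  apply: (@lt_le_trans _ _ r1); last first.
    rewrite -[r1]invrK lef_pV2 ?posrE ?invr_gt0// (le_trans (ltW e'e))//.
    by rewrite ge_min lexx.
  have e'2 : e' < 2^-1 by rewrite (lt_le_trans e'e)// !ge_min lexx !orbT.
  have := enormBD (x + z) s; have := enormD x z; have := ler_norm r.
  by rewrite /r1; move: zr se e'2; lra.
have -> : x + z = x + z - s + s by rewrite subrK.
have -> : x - s + u + t + z = x + z - s + u + t.
  by apply/rowP => i; rewrite !mxE; ring.
rewrite -translateP -(translateP t) -(translateP u) /=.
split=> h.
- have : (eball 0 e'^-1 `&` translate s L) (x + z - s).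
    by split => //; rewrite eball0.
  by rewrite E => -[].
- have : (eball 0 e'^-1 `&` translate u (translate t L0)) (x + z - s).
    by split => //; rewrite eball0.
  by rewrite -E => -[].
Qed.

Lemma pattern_discrete (e : R) :
  (forall x y, pts L0 x -> pts L0 y -> x <> y -> e < enorm (x - y)) ->
  forall L, pattern_set L0 L ->
  forall x y, pts L x -> pts L y -> x <> y -> e < enorm (x - y).
Proof.
move=> h L LO x y Lx Ly xy.
have [w E] := pattern_patch (enorm (y - x) + 1) x LO.
have h1 : pts L0 (w + 0) by apply/E; rewrite ?addr0// enorm0 ltr_wpDl// enorm_ge0.
have h2 : pts L0 (w + (y - x)).
  by apply/E; [rewrite ltrDl|rewrite addrC subrK].
have := h _ _ h1 h2; rewrite opprD addrACA subrr !add0r opprB; apply.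
move=> /addrI /esym/eqP; rewrite subr_eq0 => /eqP yx; exact/xy/esym.
Qed.

Lemma pattern_dense (r : R) : (forall x, L0 `&` eball x r !=set0) ->
  forall L, pattern_set L0 L -> forall x, L `&` eball x r !=set0.
Proof.
move=> h L LO x; have [y E] := pattern_patch r x LO.
have [p [Lp py]] := h y; exists (x + (p - y)); split.
  by apply/E => //; rewrite addrC subrK.
by rewrite /eball/= addrAC subrr add0r.
Qed.

(** The equivalence includes the condition [enorm z < r], so that the points of
    [P i] bound the translation vector [t]. *)
Lemma pattern_flc (r : R) : finite_local_complexity L0 -> 0 < r ->
  exists (n : nat) (P : 'I_n -> set 'rV[R]_d), (forall i, P i `<=` L0) /\
    forall L, pattern_set L0 L ->
      exists i t, forall z, (enorm z < r /\ pts L z) <-> P i (z + t).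
Proof.
move=> flc r0; have [n [P [clP h]]] := flc r r0.
exists n, P; split => [i|L LO]; first by have [] := clP i.
have [y E] := pattern_patch r 0 LO.
have [i [t hit]] := h y; exists i, (y + t) => z.
have -> : P i (z + (y + t)) <-> translate t (P i) (y + z).
  by rewrite translateP addrCA addrA.
rewrite -hit /eball/= [y + z]addrC addrK addrC; split=> -[zr Lz]; split=> //.
  by have /E := zr; rewrite add0r => <-.
by have /E := zr; rewrite add0r => ->.
Qed.

Lemma ultra_row_limit {T : Type} {F : set_system T} (f : T -> 'rV[R]_d) (M : R) :
  UltraFilter F -> (\forall x \near F, enorm (f x) < M) ->
  exists v, forall e : R, 0 < e -> \forall x \near F, enorm (f x - v) < e.
Proof.
move=> FU fM.
have coord x i : `|x ord0 i| <= enorm x.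
  rewrite -(@ler_pXn2r _ 2)// ?nnegrE ?enorm_ge0// enorm_sqr real_normK ?num_real//.
  by rewrite (bigD1 i)//= lerDl sumr_ge0// => j _; exact: sqr_ge0.
have /choice[v fv] : forall i, exists l : R, f x ord0 i @[x --> F] --> l.
  move=> i; apply/cvg_ex; apply: (ultra_itv_cvg (a := - M) (b := M)).
  apply: filterS fM => x fx; rewrite -ler_norml.
  exact: (le_trans (coord _ i) (ltW fx)).
exists (\row_i v i) => e e0.
have h : \sum_(i < d) `|f x ord0 i - v i| @[x --> F] --> \sum_(i < d) (0 : R).
  apply: cvg_big => [|i _]; first exact: add_continuous.
  rewrite -[X in _ --> X](@normr0 _ R^o) -(subrr (v i)).
  by apply: cvg_norm; apply: cvgB; [exact: fv|exact: cvg_cst].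
rewrite big1// in h.
apply: filterS (cvgr_lt _ h e e0) => x.
apply: le_lt_trans; apply: (le_trans (enorm_le_sum _)).
by apply: ler_sum => i _; rewrite !mxE.
Qed.

Lemma ultra_finite {T : Type} {F : set_system T} n (f : T -> 'I_n) :
  UltraFilter F -> exists i, \forall x \near F, f x = i.
Proof.
move=> FU; apply: contrapT => /forallNP h.
have hf i : F (~` [set x | f x = i]).
  by have [/h|] := in_ultra_setVsetC [set x | f x = i] FU.
have /filter_ex[x /(_ (f x))] : F [set x | forall i, f x <> i].
  exact: filter_forall.
by apply.
Qed.

Section limit.
Context {F : set_system (delone_set R d)} {FU : UltraFilter F}.
Hypothesis FO : F (pattern_set L0).
Hypothesis flc : finite_local_complexity L0.

(** The limit of [F] in the local (Chabauty-Fell) topology, which exists for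
    every ultrafilter; finite local complexity makes it the limit for [rho]. *)
Definition limit_points : set 'rV[R]_d :=
  [set x | forall e : R, 0 < e -> \forall L \near F, pts L `&` eball x e !=set0].

Let limit_delone : delone limit_points.
Proof.
have [[e e0 he] [r r0 hr]] := deloneP L0; split.
  exists (e / 2); first by rewrite divr_gt0.
  move=> x y Lx Ly xy.
  have xy0 : 0 < enorm (x - y).
    rewrite lt_neqAle enorm_ge0 andbT eq_sym; apply/eqP => /enorm0_eq0/eqP.
    by rewrite subr_eq0 => /eqP.
  pose a := Num.min (e / 4) (enorm (x - y) / 2).
  have a0 : 0 < a by rewrite lt_min !divr_gt0.
  have [ae ax] : a <= e / 4 /\ a <= enorm (x - y) / 2.
    by rewrite /a; split; rewrite ge_min lexx ?orbT.
  have [L [[[p [Lp px]] [q [Lq qy]]] LO]] :=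
    filter_ex (filterI (filterI (Lx a a0) (Ly a a0)) FO).
  rewrite /eball/= in px qy.
  have pq : p <> q.
    move=> pq; rewrite -pq in qy; have := enormBD (p - y) (p - x).
    rewrite (_ : p - y - (p - x) = x - y); first by lra.
    by apply/rowP => i; rewrite !mxE; ring.
  have := pattern_discrete he LO Lp Lq pq.
  have E' : p - q = (p - x) + (x - y) + - (q - y).
    by apply/rowP => i; rewrite !mxE; ring.
  have h3 := enormD ((p - x) + (x - y)) (- (q - y)).
  have h4 := enormD (p - x) (x - y).
  rewrite enormN -E' in h3; lra.
exists (r + 1); first by rewrite addr_gt0.
move=> x.
have /choice[p hp] : forall L, exists p,
    pattern_set L0 L -> pts L p /\ enorm (p - x) < r.
  move=> L; have [LO|nLO] := pselect (pattern_set L0 L); last by exists 0.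
  by have [p [Lp xp]] := pattern_dense hr LO x; exists p.
have [|v hv] := @ultra_row_limit _ F p (enorm x + r) FU.
  apply: filterS FO => L /hp[_ h]; have := enormD (p L - x) x.
  by rewrite subrK; lra.
exists v; split.
  move=> a a0; apply: filterS2 FO (hv a a0) => L /hp[Lp _] h.
  by exists (p L).
have [L [/hp[_ h1] h2]] := filter_ex (filterI FO (hv 1 ltr01)).
rewrite /eball/=; have -> : v - x = - (p L - v) + (p L - x).
  by apply/rowP => i; rewrite !mxE; ring.
by have := enormD (- (p L - v)) (p L - x); rewrite enormN; lra.
Qed.

(** Along [F] the patch of radius [r] is a fixed [P i] translated by vectors
    [s L] tending to some [v], so near the origin the limit is [P i]
    translated by [v], and it differs from [L] by the small shift [v - s L]. *)
Let limit_agree (e : R) : 0 < e -> \forall L \near F, agree e (pts L) limit_points.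
Proof.
(* The margin [e] leaves room for shifting [L], and for approximating limit
   points by points of [L]. *)
move=> e0; pose r := e^-1 + e.
have r0 : 0 < r by rewrite !addr_gt0// invr_gt0.
have [n [P [PL0 hP]]] := pattern_flc flc r0.
have [b b0 hb] : uniformly_discrete L0 by have [] := deloneP L0.
have [i [s [M [sM hQ]]]] : exists (i : 'I_n) (s : delone_set R d -> 'rV[R]_d)
    (M : R), (\forall L \near F, enorm (s L) < M) /\
    (\forall L \near F, forall z, (enorm z < r /\ pts L z) <-> P i (z + s L)).
  have /choice[ix hix] : forall L, exists it : 'I_n * 'rV[R]_d,
      pattern_set L0 L ->
      forall z, (enorm z < r /\ pts L z) <-> P it.1 (z + it.2).
    have [L1 [L1O _]] := filter_ex (filterI FO FO).
    have [i1 _] := hP _ L1O.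
    move=> L; have [LO|nLO] := pselect (pattern_set L0 L); last by exists (i1, 0).
    by have [i [t h]] := hP L LO; exists (i, t).
  have [i hi] := ultra_finite (fun L => (ix L).1) FU.
  have [[q Pq]|P0] := pselect (P i !=set0); last first.
    exists i, (fun=> 0), 1; split; first by apply: nearW => L; rewrite enorm0.
    apply: filterS2 FO hi => L /hix h Li z; rewrite h Li.
    by split=> Pz; exfalso; apply: P0; eexists; exact: Pz.
  exists i, (fun L => (ix L).2), (r + enorm q).
  split; last by apply: filterS2 FO hi => L /hix h <-.
  apply: filterS2 FO hi => L /hix h Li.
  have [|h1 _] := (h (q - (ix L).2)).2; first by rewrite subrK Li.
  have -> : (ix L).2 = - (q - (ix L).2) + q.
    by apply/rowP => j; rewrite !mxE; ring.
  by have := enormD (- (q - (ix L).2)) q; rewrite enormN; lra.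
have [v hv] := ultra_row_limit FU sM.
have limP x : enorm x < e^-1 -> (limit_points x <-> P i (x + v)).
  move=> xe; split=> [Lx|Px]; last first.
    move=> a a0.
    have ae0 : 0 < Num.min a e by rewrite lt_min a0.
    apply: filterS2 hQ (hv _ ae0) => L h; rewrite lt_min => /andP[ha he].
    have [|h1 h2] := (h (x + v - s L)).2; first by rewrite subrK.
    exists (x + v - s L); split => //; rewrite /eball/=.
    have -> : x + v - s L - x = - (s L - v).
      by apply/rowP => j; rewrite !mxE; ring.
    by rewrite enormN.
  have near a : 0 < a -> exists2 q, P i q & enorm (q - (x + v)) < a.
    move=> a0; have ae0 : 0 < Num.min (a / 2) e by rewrite lt_min divr_gt0.
    have [L [[[p [Lp px]] h] hs]] :=
      filter_ex (filterI (filterI (Lx _ ae0) hQ) (hv _ ae0)).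
    move: px hs; rewrite /eball/= !lt_min => /andP[p1 p2] /andP[s1 s2].
    exists (p + s L).
      apply/h; split => //; have := enormD (p - x) x.
      by rewrite subrK /r; lra.
    have -> : p + s L - (x + v) = (p - x) + (s L - v).
      by apply/rowP => j; rewrite !mxE; ring.
    by have := enormD (p - x) (s L - v); lra.
  (* Points of [P i] come arbitrarily close to [x + v] but are [b]-separated. *)
  have [|q Pq qb] := near (b / 2); first by rewrite divr_gt0.
  have [<- //|qx] := pselect (q = x + v).
  have qx0 : 0 < enorm (q - (x + v)).
    rewrite lt_neqAle enorm_ge0 andbT eq_sym; apply/eqP => /enorm0_eq0/eqP.
    by rewrite subr_eq0 => /eqP.
  have [q' Pq' qq'] := near _ qx0.
  have qnq' : q <> q' by move=> E; move: qq'; rewrite E ltxx.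
  have := hb _ _ (PL0 _ _ Pq) (PL0 _ _ Pq') qnq'.
  have -> : q - q' = (q - (x + v)) - (q' - (x + v)).
    by apply/rowP => j; rewrite !mxE; ring.
  by have := enormBD (q - (x + v)) (q' - (x + v)); lra.
apply: filterS2 hQ (hv e e0) => L h sv.
exists (v - s L), 0; rewrite !eball0 enorm0 enormB; split => //.
rewrite translate0; apply/seteqP; split => x [xe]; rewrite eball0 in xe;
  have vx : x + (v - s L) + s L = x + v by apply/rowP => j; rewrite !mxE; ring.
  rewrite translateP => Lx; split; first by rewrite eball0.
  apply/(limP _ xe); rewrite -vx; apply/h; split => //.
  by have := enormD x (v - s L); rewrite enormB /r; lra.
by move=> /(limP _ xe); rewrite -vx => /h[_ Lx]; split; rewrite ?eball0// translateP.
Qed.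

Lemma limit_pattern : exists2 L, pattern_set L0 L & F --> L.
Proof.
pose L1 := DeloneSet limit_delone.
have FL1 : F --> L1.
  move=> U /nbhs_ballP[e /= e0 eU].
  have e20 : 0 < e / 2 by rewrite divr_gt0.
  apply: filterS (limit_agree e20) => L h; apply: eU.
  rewrite ball_deloneE rho_sym; apply: (le_lt_trans (agree_rho e20 h)).
  by rewrite ltr_pdivrMr// mulr2n mulrDr mulr1 ltrDl.
have cO : closed (pattern_set L0) by exact: closed_closure.
exists L1 => //; apply: cO.
by move=> U /FL1 FU'; exact: filter_ex (filterI FO FU').
Qed.

End limit.

Lemma compact_Omega : finite_local_complexity L0 -> compact [set: Omega L0].
Proof.
move=> flc; rewrite compact_ultra => G GU _.
have FU := ultra_fmap (set_val : Omega L0 -> delone_set R d) GU.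
have FO : (set_val @ G) (pattern_set L0).
  by apply: nearW => L; exact: set_valP.
have [L /mem_set LO FL] := limit_pattern FO flc.
exists (exist _ L LO); split => // U /=.
rewrite nbhsE => -[_ [[W oW <-] /= WL] WU].
have : nbhs L W by exact: open_nbhs_nbhs.
by move=> /FL FW; exact: (filterS WU FW).
Qed.

End Compactness.

(** * Lebesgue and Gaussian measure on tuples *)

Section EuclideanLebesgue.
Context {R : realType}.
Local Notation mR := (measurableTypeR R).
Local Notation leb := (@lebesgue_measure R).

Lemma ge0_integral_shift (f : R -> \bar R) (a : R) :
  measurable_fun [set: mR] f -> (forall x, 0 <= f x)%E ->
  (\int[leb]_x f (x + a)%R = \int[leb]_x f x)%E.
Proof.
move=> mf f0.
pose sh (x : mR) : mR := x + a.
have ma : measurable_fun setT sh by exact: measurable_funD.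
transitivity (\int[pushforward leb sh]_x f x)%E.
  by rewrite ge0_integral_pushforward.
apply: eq_measure_integral => A mA _.
apply/esym/lebesgue_measure_unique => //= _ [[u v]] _ <-.
have E : sh @^-1` `]u, v]%classic = `]u - a, v - a]%classic.
  by apply/seteqP; split => x; rewrite /= !in_itv/= ltrBlDr lerBrDr.
rewrite /pushforward E !lebesgue_measure_itv/= !lte_fin ltrD2r.
by case: ifP => // _; rewrite -!EFinD; congr EFin; ring.
Qed.

Definition shift_tuple d (w : 'rV[R]_d) (s : d.-tuple mR) : d.-tuple mR :=
  [tuple tnth s i + w ord0 i | i < d].

Lemma vec_shift d w (s : d.-tuple mR) : vec (shift_tuple w s) = vec s + w.
Proof. by apply/rowP => i; rewrite !mxE tnth_mktuple. Qed.

Lemma measurable_shift_tuple d w : measurable_fun setT (@shift_tuple d w).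
Proof.
apply/measurable_fun_tnthP => i; rewrite /comp.
under eq_fun do rewrite tnth_mktuple.
apply: measurable_funD => //; exact: measurable_tnth.
Qed.

Lemma shift_tcons d w (p : mR * d.-tuple mR) :
  shift_tuple w (tcons p) =
  tcons (p.1 + w ord0 ord0, shift_tuple (\row_i w ord0 (lift ord0 i)) p.2).
Proof.
apply: eq_from_tnth => i; rewrite tnth_mktuple.
case: (unliftP ord0 i) => [j|] ->; last by rewrite !tnth0.
by rewrite !tnthS tnth_mktuple mxE.
Qed.

Lemma ge0_integral_lebesgueS d (f : d.+1.-tuple mR -> \bar R) :
  measurable_fun setT f -> (forall s, 0 <= f s)%E ->
  (\int[lebesgue d.+1]_s f s =
   \int[leb]_x \int[lebesgue d]_s f (tcons (x, s)))%E.
Proof.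
move=> mf f0.
rewrite [LHS]ge0_integral_pushforward//.
have mft := measurableT_comp mf (@measurable_tcons R d).
by rewrite preimage_setT (fubini_tonelli1 _ mft)// => p; exact: f0.
Qed.

Lemma ge0_integral_shift_tuple d (w : 'rV[R]_d) (f : d.-tuple mR -> \bar R) :
  measurable_fun setT f -> (forall s, 0 <= f s)%E ->
  (\int[lebesgue d]_s f (shift_tuple w s) = \int[lebesgue d]_s f s)%E.
Proof.
elim: d w f => [|d ih] w f mf f0.
  by apply: eq_integral => s _; congr f; apply: eq_from_tnth => -[].
have mfs : measurable_fun setT (f \o shift_tuple w).
  exact: measurableT_comp mf (measurable_shift_tuple w).
rewrite (ge0_integral_lebesgueS mfs (fun s => f0 _)) (ge0_integral_lebesgueS mf f0).
have mft := measurableT_comp mf (@measurable_tcons R d).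
pose G (x : R) : \bar R := (\int[lebesgue d]_s f (tcons (x, s)))%E.
transitivity (\int[leb]_x G (x + w ord0 ord0)%R)%E.
  apply: eq_integral => x _.
  under eq_integral do rewrite /= shift_tcons/=.
  rewrite (ih _ (fun s => f (tcons (x + w ord0 ord0, s))))//.
  exact: (measurable_fun_pair2 (x + w ord0 ord0 : mR) mft).
apply: ge0_integral_shift.
  exact: (measurable_fun_fubini_tonelli_F (m2 := lebesgue d) _ mft (fun p => f0 _)).
by move=> x; apply: integral_ge0.
Qed.

Lemma gauss_tcons d (t : R) (p : mR * d.-tuple mR) : 0 < t ->
  gauss t (vec (tcons p)) = normal_pdf 0 (Num.sqrt t) p.1 * gauss t (vec p.2).
Proof.
move=> t0; have s0 : Num.sqrt t != 0 by rewrite gt_eqF// sqrtr_gt0.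
have c0 : 0 < 2 * pi * t by rewrite !mulr_gt0// pi_gt0.
rewrite normal_pdfE//= /normal_peak /normal_fun sqr_sqrtr ?ltW//.
rewrite /gauss subr0.
have -> : enorm (vec (tcons p)) ^+ 2 = p.1 ^+ 2 + enorm (vec p.2) ^+ 2.
  rewrite !enorm_sqr big_ord_recl; congr (_ + _); first by rewrite mxE.
  by apply: eq_bigr => i _; rewrite !mxE tnthS.
have -> : (2 * pi * t) `^ (- (d.+1%:R / 2)) =
    (Num.sqrt (t * pi *+ 2))^-1 * (2 * pi * t) `^ (- (d%:R / 2)).
  have -> : t * pi *+ 2 = 2 * pi * t by ring.
  rewrite -powR12_sqrt ?ltW// -powRN -powRD; last by rewrite (gt_eqF c0) implybT.
  by congr (_ `^ _); rewrite -natr1; field.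
have -> : - ((p.1 ^+ 2 + enorm (vec p.2) ^+ 2) / (2 * t)) =
    - p.1 ^+ 2 / (t *+ 2) + - (enorm (vec p.2) ^+ 2 / (2 * t)).
  by field; rewrite !gt_eqF.
by rewrite expRD; ring.
Qed.

Lemma integral_gauss d (t : R) : 0 < t ->
  (\int[lebesgue d]_s (gauss t (vec s))%:E = 1)%E.
Proof.
move=> t0; elim: d => [|d ih].
  rewrite integral_dirac//; last by apply/measurable_EFinP; exact: measurable_gauss.
  rewrite diracT mul1e /gauss /enorm big_ord0 sqrtr0 expr0n/= !mul0r !oppr0.
  by rewrite powRr0 expR0 mulr1.
rewrite ge0_integral_lebesgueS; last 2 first.
- by apply/measurable_EFinP; exact: measurable_gauss.
- by move=> s; rewrite lee_fin gauss_ge0.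
under eq_integral => x _.
  under eq_integral do rewrite (gauss_tcons _ t0)/= EFinM.
  rewrite ge0_integralZl//; last 3 first.
  - by apply/measurable_EFinP; exact: measurable_gauss.
  - by move=> s _; rewrite lee_fin gauss_ge0.
  - by rewrite lee_fin normal_pdf_ge0.
  rewrite ih mule1.
  over.
exact: integral_normal_pdf.
Qed.

End EuclideanLebesgue.

(** * Almost invariance of the heat kernels under translations *)

Lemma ge0_integral_lin {dT : measure_display} {T : measurableType dT}
    {R : realType} (m : {measure set T -> \bar R}) (f g : T -> R) (k : R) :
  measurable_fun setT f -> measurable_fun setT g ->
  (forall x, 0 <= f x) -> (forall x, 0 <= g x) -> 0 <= k ->
  (\int[m]_x (f x + k * g x)%:E =
   \int[m]_x (f x)%:E + k%:E * \int[m]_x (g x)%:E)%E.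
Proof.
move=> mf mg f0 g0 k0; under eq_integral do rewrite EFinD.
rewrite ge0_integralD//.
- congr (_ + _)%E; under eq_integral do rewrite EFinM.
  rewrite ge0_integralZl//; first exact/measurable_EFinP.
  by move=> x _; rewrite lee_fin.
- by move=> x _; rewrite lee_fin.
- exact/measurable_EFinP.
- by move=> x _; rewrite lee_fin mulr_ge0.
- by apply/measurable_EFinP; exact: measurable_funM.
Qed.

Section HeatShift.
Context {R : realType} {d : nat} (L0 : delone_set R d).
Local Notation mR := (measurableTypeR R).
Implicit Types (s w : 'rV[R]_d) (L : Omega L0) (A : set (Borel L0)).

Lemma phiD s w L : phi s (phi w L) = phi (w + s) L.
Proof. by apply/val_inj; rewrite /= shiftD. Qed.

Lemma phi0 L : phi 0 L = L.
Proof. by apply/val_inj; rewrite /= Defs.shift0. Qed.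

Lemma phiK s : cancel (phi s : Omega L0 -> Omega L0) (phi (- s)).
Proof. by move=> L; rewrite phiD subrr phi0. Qed.

Lemma phiNK s : cancel (phi (- s) : Omega L0 -> Omega L0) (phi s).
Proof. by move=> L; rewrite phiD addNr phi0. Qed.

Lemma continuous_phi s : continuous (phi s : Omega L0 -> Omega L0).
Proof.
move=> L U; rewrite {1}nbhsE/= => -[_ [[W oW <-] /= WL] WU].
have Wn : nbhs (dshift s (val L)) W by exact: open_nbhs_nbhs.
have /(_ _ Wn) h := shift_continuous (t := s) (x := val L).
change (nbhs L ((phi s : Omega L0 -> Omega L0) @^-1` U)).
apply: (filterS (P := set_val @^-1` (dshift s @^-1` W))).
  by move=> L' /= ?; exact: WU.
by apply: (@initial_continuous _ _ set_val); exact: h.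
Qed.

Lemma measurable_phi_preimage s A : measurable A ->
  measurable ((phi s : Borel L0 -> Borel L0) @^-1` A).
Proof.
move=> mA; rewrite -[X in measurable X]setTI.
exact: (continuous_borel (@continuous_phi s)).
Qed.

Lemma measurable_gauss_shift (t : R) w :
  measurable_fun setT (fun u : d.-tuple mR => gauss t (vec u - w)).
Proof.
under eq_fun do rewrite -vec_shift.
exact: (measurableT_comp (measurable_gauss t) (measurable_shift_tuple (- w))).
Qed.

Lemma integral_gauss_shift (t : R) w : 0 < t ->
  (\int[lebesgue d]_u (gauss t (vec u - w))%:E = 1)%E.
Proof.
move=> t0; rewrite -[RHS](integral_gauss d t0).
rewrite -(ge0_integral_shift_tuple (- w) (f := fun u => (gauss t (vec u))%:E)).
- by apply: eq_integral => u _; rewrite vec_shift.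
- by apply/measurable_EFinP; exact: measurable_gauss.
- by move=> u; rewrite lee_fin gauss_ge0.
Qed.

Lemma heat_total (t : R) L : 0 < t -> heat_kernel t (L : Borel L0) setT = 1%E.
Proof.
move=> t0; rewrite -[RHS](integral_gauss d t0); apply: eq_integral => u _.
by rewrite indicT mulr1.
Qed.

Lemma heat_fin (t : R) L A : 0 < t -> measurable A ->
  heat_kernel t (L : Borel L0) A \is a fin_num.
Proof.
move=> t0 mA; rewrite ge0_fin_numE; last exact: (measure_ge0 (heat_kernel t L)).
apply: (@le_lt_trans _ _ (heat_kernel t (L : Borel L0) setT)).
  by apply: (le_measure (heat_kernel t L)) => //; exact: mem_set.
by rewrite heat_total// ltry.
Qed.

Lemma heat_preimage (t : R) L s A : measurable A ->
  heat_kernel t (L : Borel L0) (phi s @^-1` A) =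
  (\int[lebesgue d]_u (gauss t (vec u - s) * \1_A (phi (vec u) L))%:E)%E.
Proof.
move=> mA; rewrite -(ge0_integral_shift_tuple s).
- apply: eq_integral => u _; rewrite vec_shift addrK !indicE.
  by rewrite -phiD; congr (_ * _%:R)%:E; congr nat_of_bool; apply/idP/idP;
    move/set_mem => h; apply/mem_set.
- apply/measurable_EFinP; apply: measurable_funM; first exact: measurable_gauss_shift.
  have m1 : measurable_fun setT (\1_A : Borel L0 -> R) by exact: measurable_indic.
  exact: (measurableT_comp m1 (measurable_phi1 (L : Borel L0))).
- by move=> u; rewrite lee_fin mulr_ge0// ?gauss_ge0// indicE.
Qed.

(** The parallelogram law for [u] and [u - 2 s], exponentiated. *)
Lemma gauss_parallelogram (t : R) u s : 0 < t ->
  gauss t u * (expR (enorm s ^+ 2 / t) * gauss t (u - s - s)) =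
  gauss t (u - s) ^+ 2.
Proof.
move=> t0; rewrite /gauss; set c := _ `^ _.
have -> : enorm u ^+ 2 = 2 * enorm (u - s) ^+ 2 + 2 * enorm s ^+ 2 -
    enorm (u - s - s) ^+ 2.
  rewrite !enorm_sqr !mulr_sumr -big_split/= -sumrB; apply: eq_bigr => i _.
  by rewrite !mxE; ring.
set a := enorm (u - s) ^+ 2; set b := enorm s ^+ 2; set e := enorm _ ^+ 2.
have -> : c * expR (- ((2 * a + 2 * b - e) / (2 * t))) *
    (expR (b / t) * (c * expR (- (e / (2 * t))))) =
    c ^+ 2 * (expR (- ((2 * a + 2 * b - e) / (2 * t))) * expR (b / t) *
     expR (- (e / (2 * t)))) by ring.
rewrite -!expRD exprMn [expR _ ^+ 2]expr2 -expRD.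
by congr (_ * expR _); field; rewrite gt_eqF.
Qed.

(** With [v = 1], this says that [b - a <= e * a + (b - a) ^+ 2 / (4 * e * a)],
    where [c] eliminates the quotient: [(b - a) ^+ 2 / a = c - 2 b + a]. The
    terms are grouped so that both sides are nonnegative. *)
Lemma shift_pointwise (a b c e : R) (v : bool) : 0 < a -> 0 < e ->
  a * c = b ^+ 2 ->
  b * v%:R + (2 * e)^-1 * b <= a * v%:R + (e + (4 * e)^-1) * a + (4 * e)^-1 * c.
Proof.
move=> a0 e0 acb; have -> : c = b ^+ 2 / a by rewrite -acb mulrC mulKf// gt_eqF.
rewrite -subr_ge0; set D := (X in 0 <= X).
have -> : D = ((2 * e * a) ^+ 2 - 4 * e * a * (b - a) * v%:R + (b - a) ^+ 2) /
    (4 * e * a).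
  by rewrite /D; field; rewrite !gt_eqF.
rewrite divr_ge0//; last by rewrite !mulr_ge0// ltW.
case: (v); rewrite /= ?mulr1 ?mulr0.
  have -> : (2 * e * a) ^+ 2 - 4 * e * a * (b - a) + (b - a) ^+ 2 =
    (2 * e * a - (b - a)) ^+ 2 by ring.
  exact: sqr_ge0.
by rewrite subr0 addr_ge0// sqr_ge0.
Qed.

(** [shift_pointwise] integrated with [a], [b] and [c] the values of the Gaussian
    density at [u], at [u - s], and at [u - 2 s] times [expR (|s| ^+ 2 / t)]. *)
Lemma heat_shift_le (t e : R) L s A : 0 < t -> 0 < e -> measurable A ->
  fine (heat_kernel t (L : Borel L0) (phi s @^-1` A)) <=
  fine (heat_kernel t (L : Borel L0) A) +
    (e + (expR (enorm s ^+ 2 / t) - 1) / (4 * e)).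
Proof.
move=> t0 e0 mA; set E := expR _.
have mchi : measurable_fun setT
    (fun u : d.-tuple mR => \1_A (phi (vec u) L : Borel L0) : R).
  have m1 : measurable_fun setT (\1_A : Borel L0 -> R) by exact: measurable_indic.
  exact: (measurableT_comp m1 (measurable_phi1 (L : Borel L0))).
have mg w : measurable_fun setT (fun u : d.-tuple mR => gauss t (vec u - w)).
  exact: measurable_gauss_shift.
have mg0 := measurable_gauss (d := d) t.
have g0 w : 0 <= gauss t w by exact: gauss_ge0.
have c0 u : 0 <= \1_A (phi (vec u) L : Borel L0) :> R by rewrite indicE.
have E0 : 0 <= E by exact: expR_ge0.
have : (\int[lebesgue d]_u (gauss t (vec u - s) * \1_A (phi (vec u) L : Borel L0)
      + (2 * e)^-1 * gauss t (vec u - s))%:E <=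
    \int[lebesgue d]_u (gauss t (vec u) * \1_A (phi (vec u) L : Borel L0)
      + (e + (4 * e)^-1) * gauss t (vec u)
      + (4 * e)^-1 * E * gauss t (vec u - (s + s)))%:E)%E.
  apply: ge0_le_integral => //.
  - by move=> u _; rewrite lee_fin addr_ge0// mulr_ge0// invr_ge0 mulr_ge0// ltW.
  - by apply/measurable_EFinP; apply: measurable_funD; apply: measurable_funM.
  - apply/measurable_EFinP; apply: measurable_funD; last exact: measurable_funM.
    by apply: measurable_funD; exact: measurable_funM.
  - move=> u _; rewrite lee_fin -[in leRHS]mulrA opprD addrA indicE.
    apply: shift_pointwise => //; last exact: gauss_parallelogram.
    by rewrite mulr_gt0 ?expR_gt0 ?powR_gt0// mulr_gt0// mulr_gt0// pi_gt0.
have k0 : 0 <= (2 * e)^-1 by rewrite invr_ge0 mulr_ge0// ltW.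
have k1 : 0 <= (4 * e)^-1 by rewrite invr_ge0 mulr_ge0// ltW.
have mgc w : measurable_fun setT (fun u : d.-tuple mR =>
    gauss t (vec u - w) * \1_A (phi (vec u) L : Borel L0)).
  exact: measurable_funM.
have mgc0 : measurable_fun setT (fun u : d.-tuple mR =>
    gauss t (vec u) * \1_A (phi (vec u) L : Borel L0)).
  exact: measurable_funM.
have gc0 w u : 0 <= gauss t w * \1_A (phi (vec u) L : Borel L0).
  by apply: mulr_ge0.
have k2 : 0 <= e + (4 * e)^-1 by rewrite addr_ge0// ltW.
rewrite (ge0_integral_lin _ (mgc s) (mg s) (fun u => gc0 _ u) (fun u => g0 _) k0).
rewrite (ge0_integral_lin _ _ (mg (s + s)))//; last 3 first.
- by apply: measurable_funD => //; exact: measurable_funM.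
- by move=> u; apply: addr_ge0; [exact: gc0|exact: mulr_ge0].
- exact: mulr_ge0.
rewrite (ge0_integral_lin _ mgc0 mg0 (fun u => gc0 _ u) (fun u => g0 _) k2).
rewrite (integral_gauss_shift s t0) (integral_gauss_shift (s + s) t0).
rewrite (integral_gauss d t0) !mule1.
rewrite -(heat_preimage t L s mA).
rewrite -[X in (_ <= X + _ + _)%E -> _]/(heat_kernel t (L : Borel L0) A).
rewrite -(fineK (heat_fin L t0 mA)).
rewrite -(fineK (heat_fin L t0 (measurable_phi_preimage s mA))).
rewrite -!EFinD lee_fin => h; rewrite -(lerD2r (2 * e)^-1).
apply: (le_trans h); rewrite le_eqVlt; apply/orP; left; apply/eqP.
by field; rewrite gt_eqF.
Qed.

(** The reverse inequality is [heat_shift_le] for [- s] and the set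
    [phi s @^-1` A]. *)
Lemma heat_asymptotic_invariance (s : 'rV[R]_d) L A : measurable A ->
  fine (heat_kernel t (L : Borel L0) (phi s @^-1` A)) -
  fine (heat_kernel t (L : Borel L0) A) @[t --> +oo] --> 0.
Proof.
move=> mA; apply/cvgr0Pnorm_lt => e e0.
have e20 : 0 < e / 2 by rewrite divr_gt0.
pose q := enorm s ^+ 2.
(* With the parameter [e / 2], the bound of [heat_shift_le] tends to [e / 2]. *)
have Ecvg : (e / 2 + (expR (q / t) - 1) / (4 * (e / 2))) @[t --> +oo] -->
    e / 2 + (expR 0 - 1) / (4 * (e / 2)).
  apply: cvgD; first exact: cvg_cst.
  apply: cvgM; last exact: cvg_cst.
  apply: cvgB; last exact: cvg_cst.
  apply: (continuous_cvg _ (@continuous_expR R 0)).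
  rewrite -(mulr0 q); apply: cvgM; first exact: cvg_cst.
  by apply/gtr0_cvgV0; [exact: nbhs_pinfty_gt|exact: cvg_id].
rewrite expR0 subrr mul0r addr0 in Ecvg.
near=> t.
have t0 : 0 < t by near: t; exact: nbhs_pinfty_gt.
have te : e / 2 + (expR (q / t) - 1) / (4 * (e / 2)) < e.
  near: t; apply: (cvgr_lt _ Ecvg).
  by rewrite ltr_pdivrMr// ltr_pMr// ltr1n.
have h1 := heat_shift_le L s t0 e20 mA.
have := heat_shift_le L (- s) t0 e20 (measurable_phi_preimage s mA).
have -> : (phi (- s) : Omega L0 -> Omega L0) @^-1` (phi s @^-1` A) = A.
  by rewrite -comp_preimage (_ : _ \o _ = id)//; apply/funext => L' /=; exact: phiNK.
rewrite enormN -/q => h2; rewrite -/q in h1.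
by rewrite ltr_norml; apply/andP; split; move: h1 h2 te; lra.
Unshelve. all: by end_near. Qed.

End HeatShift.

(** * Invariance and convergence *)

Section Ergodic.
Context {R : realType} {d : nat} (L0 : delone_set R d).
Hypothesis flc : finite_local_complexity L0.
Local Notation mR := (measurableTypeR R).

Lemma bounded_borel_integrable (m : probability (Borel L0) R) (f : Omega L0 -> R)
  (M : R) : measurable_fun [set: Borel L0] f -> (forall x, `|f x| <= M) ->
  m.-integrable setT (fun x : Borel L0 => (f x)%:E).
Proof.
move=> mf fM; apply: measurable_bounded_integrable => //.
  exact: (le_lt_trans (probability_le1 m measurableT) (ltry 1)).

exists M; split; first by rewrite num_real.
by move=> c Mc x _ /=; rewrite (le_trans (fM x))// ltW.
Qed.

Lemma integral_phi (m : probability (Borel L0) R) (f : Omega L0 -> R) s :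
  translation_invariant m -> continuous f ->
  (\int[m]_L (f (phi s L))%:E = \int[m]_L (f L)%:E)%E.
Proof.
move=> minv cf.
have [M M0 fM] := continuous_compact_bounded (compact_Omega flc) cf.
have mf : measurable_fun [set: Borel L0] f by exact: continuous_measurable.
have mphi : measurable_fun setT (phi s : Borel L0 -> Borel L0).
  exact: (continuous_borel (@continuous_phi _ _ L0 s)).
transitivity (\int[pushforward m (phi s : Borel L0 -> Borel L0)]_L (f L)%:E)%E.
  rewrite integral_pushforward//; first exact/measurable_EFinP.
  rewrite preimage_setT /comp.
  apply: bounded_borel_integrable => [|x]; [|exact: fM].
  exact: (measurableT_comp mf mphi).
by apply: eq_measure_integral => A mA _; exact: minv.
Qed.

(** After exchanging the integrals, the inner one is given by [integral_phi] and
    the Gaussian in the outer one has total mass [1]. *)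
Lemma heat_semigroup_invariant (m : probability (Borel L0) R) :
  translation_invariant m -> semigroup_invariant m.
Proof.
move=> minv f t cf t0.
have [M M0 fM] := continuous_compact_bounded (compact_Omega flc) cf.
have mf : measurable_fun [set: Borel L0] f by exact: continuous_measurable.
have mg := measurable_gauss (R := R) (d := d) t.
have intg : (lebesgue d).-integrable setT
    (fun u : d.-tuple mR => (gauss t (vec u))%:E).
  apply/integrableP; split; first exact/measurable_EFinP.
  under eq_integral do rewrite /= ger0_norm ?gauss_ge0//.
  by rewrite integral_gauss// ltry.
pose F (p : Borel L0 * d.-tuple mR) :=
  (gauss t (vec p.2) * f (phi (vec p.2) p.1))%:E.
have mF : measurable_fun setT F.
  apply/measurable_EFinP; apply: measurable_funM.
    exact: (measurableT_comp mg measurable_snd).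
  exact: (measurableT_comp mf (@measurable_phi _ _ L0)).
have iF : (m \x lebesgue d)%E.-integrable setT F.
  pose H (p : Borel L0 * d.-tuple mR) := (M * gauss t (vec p.2))%:E.
  have mH : measurable_fun setT H.
    apply/measurable_EFinP; apply: measurable_funM => //.
    exact: (measurableT_comp mg measurable_snd).
  apply: (@le_integrable _ _ _ _ _ _ F H) => //.
    move=> p _; rewrite lee_fin !normrM mulrC ler_wpM2r//.
    by rewrite (le_trans (fM _))// ler_norm.
  apply/integrable12ltyP => //.
  have E L : (\int[lebesgue d]_u `|H (L, u)| = M%:E)%E.
    under eq_integral do rewrite /H/= normrM !ger0_norm ?gauss_ge0 ?(ltW M0)// EFinM.
    by rewrite (integralZl measurableT intg) (integral_gauss d t0) mule1.
  under eq_integral do rewrite E.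
  rewrite integral_cst//; apply: lte_mul_pinfty => //; first by rewrite lee_fin ltW.
  exact: (le_lt_trans (probability_le1 m measurableT) (ltry 1)).
rewrite /heat_semigroup (Fubini iF)/=.
have cfin : (\int[m]_L (f L)%:E)%E \is a fin_num.
  by apply: integrable_fin_num => //; exact: (bounded_borel_integrable m mf fM).
transitivity (\int[lebesgue d]_u ((gauss t (vec u))%:E * \int[m]_L (f L)%:E))%E.
  apply: eq_integral => u _; rewrite -(integral_phi (vec u) minv cf).
  under eq_integral do rewrite /F/= EFinM.
  rewrite integralZl//.
  apply: bounded_borel_integrable => [|x]; [|exact: fM].
  apply: (measurableT_comp mf).
  exact: (continuous_borel (@continuous_phi _ _ L0 (vec u))).
by rewrite -(fineK cfin) (integralZr measurableT intg) (integral_gauss d t0) mul1e.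
Qed.

(** The limit of the heat kernels along any ultrafilter at infinity is
    translation invariant, hence is [m]. *)
Lemma heat_kernel_cvg (m : probability (Borel L0) R) (L : Omega L0) :
  uniquely_ergodic_with m -> weakly_converges (fun t => heat_kernel t L) m.
Proof.
move=> [minv muniq] g cg; apply: cvg_ultra => G GU FG.
have G0 : \forall t \near G, 0 < t by apply: FG; exact: nbhs_pinfty_gt.
have nuT : \forall t \near G, heat_kernel t (L : Borel L0) setT = 1%E.
  by apply: filterS G0 => t; exact: heat_total.
have [P [Pinv Pcvg]] := @ultra_weak_limit R (Omega L0) (compact_Omega flc)
  pseudometric_normal R G GU (fun t => heat_kernel t (L : Borel L0)) nuT.
have PE : forall A, measurable A -> P A = m A.
  apply: muniq => s A mA.
  apply: (Pinv (phi s) (phi (- s))) => [||||B mB].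
  - exact: continuous_phi.
  - exact: continuous_phi.
  - exact: phiK.
  - exact: phiNK.
  - by move=> U /(heat_asymptotic_invariance s L mB); exact: FG.
have -> : (\int[m]_x (g x)%:E = \int[P]_x (g x)%:E)%E.
  by apply: eq_measure_integral => A mA _; exact/esym/PE.
exact: Pcvg.
Qed.

Lemma adjoint_semigroup_cvg (m : probability (Borel L0) R) (L : Omega L0) :
  uniquely_ergodic_with m ->
  weakly_converges (fun t => adjoint_semigroup t \d_(L : Borel L0)) m.
Proof.
move=> mue g cg; have h := heat_kernel_cvg L mue cg; apply: (cvg_trans _ h).
apply: near_eq_cvg; apply: nearW => t.
by apply: eq_measure_integral => A mA _; exact/esym/adjoint_dirac.
Qed.

End Ergodic.

Theorem proposition3p5 (R : realType) (d : nat) (L0 : delone_set R d)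
  (L0_aperiodic : aperiodic L0) (L0_repetitive : repetitive L0)
  (L0_flc : finite_local_complexity L0)
  (mu : probability (Borel L0) R) (mu_ue : uniquely_ergodic_with mu) :
  semigroup_invariant mu /\
  forall L : Omega L0,
    weakly_converges (fun t => heat_kernel t L) mu /\
    weakly_converges (fun t => adjoint_semigroup t \d_(L : Borel L0)) mu.
Proof.
split; first by case: mu_ue => minv _; exact: heat_semigroup_invariant.
by move=> L; split; [exact: heat_kernel_cvg|exact: adjoint_semigroup_cvg].
Qed.
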